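(* Suppose $X,X_1,\ldots,X_m$, $Y,Y_1,\ldots,Y_n$ are independent random variables with zero mean and unit variance, with $X_i\stackrel{\mathcal{D}}{=}X$ for all $i=1,\ldots,m$ and $Y_j\stackrel{\mathcal{D}}{=}Y$ for all $j=1,\ldots,n$, and suppose that $\mathbb{E}X^3=\mathbb{E}Y^3=0$ and $\mathbb{E}X^4,\mathbb{E}Y^4<\infty$. Let $W_1=\sum_{i=1}^mX_i$, $W_2=\sum_{j=1}^nY_j$ and set $W=\frac{1}{\sqrt{mn}}W_1W_2$. Then, for $h\in C_b^2(\mathbb{R})$, we have $$|\mathbb{E}h(W)-\mathrm{PN}_2^1h|\leq\bigg(\frac1m+\frac1n\bigg)\bigg[\frac72\|h''\|+\|h'\|+\frac{123}{4}\|h-\mathrm{PN}_2^1h\|\bigg]\mathbb{E}X^4\,\mathbb{E}Y^4.$$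
   Context: $\mathrm{PN}_2^1h=\mathbb{E}h(Z_1Z_2)$ with $Z_1,Z_2$ independent $N(0,1)$ random variables. $C_b^2(\mathbb{R})$ is the space of bounded functions on $\mathbb{R}$ with bounded derivatives of order $1$ and $2$. $\|g\|=\sup_{x\in\mathbb{R}}|g(x)|$. $\stackrel{\mathcal{D}}{=}$ is equality in distribution. *)

(* Defs.v *)
From mathcomp Require Import all_boot all_order all_algebra.
From mathcomp Require Import all_classical all_reals all_analysis.
Import Order.TTheory GRing.Theory Num.Theory.
Import numFieldNormedType.Exports.

Set Implicit Arguments.
Unset Strict Implicit.
Unset Printing Implicit Defensive.

Local Open Scope ring_scope.
Local Open Scope classical_set_scope.

(* Mutual independence; taking A i = setT would make the product rule over the
   whole of I sufficient, but the usual form over all subfamilies is used. *)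
Definition mutually_independent (d : measure_display) (T : measurableType d)
    (R : realType) (P : probability T R) (I : finType)
    (X : I -> {RV P >-> R}) : Prop :=
  forall (J : {set I}) (A : I -> set R), (forall i, measurable (A i)) ->
    P (\bigcap_(i in [set` J]) X i @^-1` A i)
      = (\prod_(i in J) P (X i @^-1` A i))%E.

(* Equality is only required on measurable sets: the value of a measure
   elsewhere is unspecified. *)
Definition eq_in_distribution (d : measure_display) (T : measurableType d)
    (R : realType) (P : probability T R) (X Y : {RV P >-> R}) : Prop :=
  forall A : set R, measurable A -> distribution P X A = distribution P Y A.

(* A variable together with its copies, [None] indexing the variable itself. *)
Definition with_copies (U : Type) (k : nat) (x : U) (xs : 'I_k -> U)
    (i : option 'I_k) : U := if i is Some j then xs j else x.

Definition join_families (U I J : Type) (x : I -> U) (y : J -> U)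
    (k : I + J) : U :=
  match k with inl i => x i | inr j => y j end.

Definition Cb2 (R : realType) (h : R -> R) : Prop :=
  [/\ forall x, derivable h x 1,
      forall x, derivable h^`() x 1 &
      [/\ bounded_fun h, bounded_fun h^`() & bounded_fun h^`(2)]].

(* Meaningful for bounded functions ([sup] is 0 on unbounded sets). *)
Definition supnorm (R : realType) (g : R -> R) : R :=
  sup (range (fun x => `|g x|)).

(* Z_1 and Z_2 are the coordinates of the product space. *)
Definition PN21 (R : realType) (h : R -> R) : R :=
  fine 'E_(normal_prob (0 : R) 1 \x normal_prob (0 : R) 1)%E
         [fun z => h (z.1 * z.2)%R].

(* Main.v *)
Require Import Defs.
From mathcomp Require Import all_boot all_order all_algebra.
From mathcomp Require Import all_classical all_reals all_analysis.
From mathcomp Require Import measurable_realfun ring lra.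
Import Order.TTheory GRing.Theory Num.Theory.
Import numFieldNormedType.Exports.

Set Implicit Arguments.
Unset Strict Implicit.
Unset Printing Implicit Defensive.

Local Open Scope ring_scope.
Local Open Scope classical_set_scope.

(** Put S = W1 / sqrt m and U = W2 / sqrt n, so that W = S U with S and U
    independent.  Replace S by a standard normal Z1 and then U by Z2, one at a
    time.  For a fixed value u of the other factor the test function is
    g(s) = h(s u), whose second derivative is at most u^2 ||h''||, and the
    one-dimensional normal approximation below costs (8/3) u^2 ||h''|| E X^4 / m.
    Averaging over u gives a factor E U^2 = 1 in the first replacement and
    E Z1^2 <= 1 in the second ([mixture_comparison]).  The total is
    (8/3) ||h''|| (E X^4 / m + E Y^4 / n), which is below the claimed bound
    since fourth moments of unit-variance variables are at least 1.

    The one-dimensional estimate ([normalized_sum_clt_bound]) has rate 1/m with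
    two derivatives of g only, because third moments vanish.  Let f solve
    Stein's equation f'(x) - x f(x) = g(x) - E g(Z), and let S_i be S without
    its i-th summand.  Expanding f'(S_i + X_i / sqrt m) to first order and
    X_i f(S_i + X_i / sqrt m) to third order in X_i, and averaging over X_i
    alone, all terms cancel except remainders of size ||f'''|| / m
    ([stein_summand_bound]); summing over i bounds E f'(S) - E S f(S), which is
    E g(S) - E g(Z).

    It remains to bound f''' by ||g''|| ([stein_solution]).  Two facts about
    differential equations suffice.  First, a function v of moderate growth with
    |v'(x) - x v(x)| <= K satisfies |x v(x)| <= K: otherwise v minus a constant,
    multiplied by the normal density, would be monotone and bounded away from 0
    ([stein_ode_bound]).  Secondly, the bounded function w = f' solves
    w'' - x w' - 2 w = g'', so the maximum principle gives ||f'|| <= ||g''|| / 2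
    ([max_principle]).  Then v = f'' satisfies v' - x v = g'' + 2 f', of size at
    most 2 ||g''||, and the first fact gives
    ||f'''|| <= 2 ||g''|| + 2 ||g''|| = 4 ||g''||. *)

(** * Integrals *)

Definition mfun_of d d' (T : measurableType d) (T' : measurableType d')
    (f : T -> T') (mf : measurable_fun setT f) : {mfun T >-> T'} :=
  MeasurableFun.Pack (MeasurableFun.Class (isMeasurableFun.Build _ _ _ _ _ mf)).

Section bounded_functions.
Context (R : realType) (d : measure_display) (T : measurableType d).
Variable P : probability T R.
Implicit Types (f : T -> R) (A : set T) (B : R).

Lemma bounded_integrable_on A f B : measurable A -> measurable_fun A f ->
  (forall x, A x -> `|f x| <= B) -> P.-integrable A (EFin \o f).
Proof.
move=> mA mf fB; apply: measurable_bounded_integrable => //.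
  by rewrite (le_lt_trans (probability_le1 _ _))// ltry.
exists B; split; [exact: num_real|move=> M BM x Ax; apply: le_trans (ltW BM)].
exact: fB.
Qed.

Lemma bounded_integrable f B : measurable_fun setT f -> (forall x, `|f x| <= B) ->
  P.-integrable setT (EFin \o f).
Proof. by move=> mf fB; exact: (@bounded_integrable_on _ _ B). Qed.

Lemma Rintegral_bound f A B : measurable_fun setT f -> measurable A ->
  (forall x, `|f x| <= B) ->
  `|\int[P]_(x in A) f x| <= B * fine (P A).
Proof.
move=> mf mA fB; have fi := bounded_integrable mf fB.
have fAi : P.-integrable A (EFin \o f) by exact: integrableS fi.
apply: le_trans (le_normr_Rintegral mA fAi) _.
rewrite -Rintegral_cst//; apply: le_Rintegral => //.
  exact: integrable_norm.
exact: finite_measure_integrable_cst.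
Qed.

Lemma Rintegral_centered f : P.-integrable setT (EFin \o f) ->
  \int[P]_x (f x - \int[P]_y f y) = 0.
Proof.
move=> fi; set c := \int[P]_y f y.
have ci : P.-integrable setT (EFin \o cst c) by exact: finite_measure_integrable_cst.
have Pc : \int[P]_x cst c x = c.
  by rewrite Rintegral_cst//= probability_setT mulr1.
by rewrite (RintegralB measurableT fi ci) Pc subrr.
Qed.

End bounded_functions.

Section integral_helpers.
Context (R : realType) (d : measure_display) (T : measurableType d).
Variable mu : {measure set T -> \bar R}.

Lemma integrable_dominated (f g : T -> R) : measurable_fun setT f ->
  mu.-integrable setT (EFin \o g) -> (forall x, `|f x| <= g x) ->
  mu.-integrable setT (EFin \o f).
Proof.
move=> mf ig fg; apply: (le_integrable measurableT _ _ ig).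
  exact/measurable_EFinP.
move=> x _; rewrite /= lee_fin (le_trans (fg x))//.
by rewrite real_ler_norm ?num_real.
Qed.

Lemma norm_Rintegral_le (f g : T -> R) : measurable_fun setT f ->
  mu.-integrable setT (EFin \o g) -> (forall x, `|f x| <= g x) ->
  `|\int[mu]_x f x| <= \int[mu]_x g x.
Proof.
move=> mf ig fg; have fi := integrable_dominated mf ig fg.
apply: (le_trans (le_normr_Rintegral measurableT fi)).
by apply: le_Rintegral => //; exact: integrable_norm.
Qed.

End integral_helpers.

Section finite_sums.
Context (R : realType) (d : measure_display) (T : measurableType d).
Variable mu : {measure set T -> \bar R}.

Lemma Rintegral_sum (I : eqType) (s : seq I) (F : I -> T -> R) :
  {in s, forall i, mu.-integrable setT (EFin \o F i)} ->
  mu.-integrable setT (EFin \o (fun x => \sum_(i <- s) F i x)) /\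
  \int[mu]_x (\sum_(i <- s) F i x) = \sum_(i <- s) \int[mu]_x F i x.
Proof.
elim: s => [_|i s IH Fi].
  rewrite big_nil; have -> : (fun x => \sum_(i <- [::]) F i x) = cst 0.
    by apply/funext => x; rewrite big_nil.
  split; first exact: integrable0.
  by rewrite /Rintegral integral0.
have [|is_ Is] := IH; first by move=> k ks; apply: Fi; rewrite inE ks orbT.
have ii : mu.-integrable setT (EFin \o F i) by apply: Fi; rewrite mem_head.
have -> : (fun x => \sum_(k <- i :: s) F k x) = (fun x => F i x + \sum_(k <- s) F k x).
  by apply/funext => x; rewrite big_cons.
split; last by rewrite big_cons RintegralD// Is.
rewrite (_ : EFin \o _ = ((EFin \o F i) \+
  (EFin \o (fun x => (\sum_(k <- s) F k x)%R)))%E)//.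
exact: integrableD.
Qed.

End finite_sums.

Section integrals_under_a_law.
Context (d d' : measure_display) (T : measurableType d) (T' : measurableType d').
Variables (R : realType) (P : probability T R) (X : {mfun T >-> T'}) (f : T' -> R).

Lemma integrable_distribution_comp : (distribution P X).-integrable setT (EFin \o f) ->
  P.-integrable setT (fun w => (f (X w))%:E).
Proof.
move=> /integrableP[mf fin]; apply/integrableP; split.
  by apply: (measurableT_comp mf).
by move: fin; rewrite ge0_integral_distribution//; exact: measurableT_comp.
Qed.

Lemma Rintegral_distribution : (distribution P X).-integrable setT (EFin \o f) ->
  \int[distribution P X]_x f x = \int[P]_w f (X w).
Proof.
move=> fi; congr fine; apply: integral_distribution; last exact: integrable_distribution_comp.
exact: measurable_int fi.
Qed.

End integrals_under_a_law.

(** * Derivatives and monotonicity *)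

Section calculus.
Variable R : realType.
Implicit Types (f v w g : R -> R) (x t a b K L M : R).

Lemma is_derive_continuous_at f df x : is_derive x 1 f df -> {for x, continuous f}.
Proof. by move=> [d _]; apply/differentiable_continuous/derivable1_diffP. Qed.

Lemma is_derive_within f df (A : set R) :
  (forall x, is_derive x 1 f (df x)) -> {within A, continuous f}.
Proof.
move=> fd; apply: continuous_subspaceT => x.
exact: is_derive_continuous_at (fd x).
Qed.

Lemma MVT_le f df a b : (forall x, is_derive x 1 f (df x)) -> a <= b ->
  exists2 c, a <= c <= b & f b - f a = df c * (b - a).
Proof.
move=> fd ab.
have [|c /[!in_itv]/= cab E] := MVT_segment ab (fun x _ => fd x).
  exact: is_derive_within fd.
by exists c.
Qed.

Lemma lipschitz_of_bounded_deriv f df K : (forall x, is_derive x 1 f (df x)) ->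
  (forall x, `|df x| <= K) -> forall a b, `|f b - f a| <= K * `|b - a|.
Proof.
move=> fd bd a b; have [ab|/ltW ba] := leP a b.
  by have [c _ ->] := MVT_le fd ab; rewrite normrM ler_wpM2r.
by have [c _ E] := MVT_le fd ba; rewrite distrC E normrM distrC ler_wpM2r.
Qed.

Lemma ge0_deriv_le f df a b : (forall x, is_derive x 1 f (df x)) ->
  (forall x, a <= x -> 0 <= df x) -> a <= b -> f a <= f b.
Proof.
move=> fd df0 ab; have [c /andP[ac _] E] := MVT_le fd ab.
by rewrite -subr_ge0 E mulr_ge0 ?subr_ge0// df0.
Qed.

Lemma is_derive_reflect f df x : is_derive (- x) 1 f df ->
  is_derive x 1 (f \o -%R) (- df).
Proof.
move=> fd; have := is_derive1_comp fd (is_deriveNid x 1).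
by rewrite mulrN1.
Qed.

(** * The equation v' - x v = k *)

Definition stdpdf : R -> R := normal_pdf 0 1.

Lemma stdpdfE x : stdpdf x = normal_peak 1 * expR (- x ^+ 2 / 2).
Proof.
by rewrite /stdpdf normal_pdfE ?oner_neq0// /normal_fun subr0 expr1n.
Qed.

Lemma stdpdf_gt0 x : 0 < stdpdf x.
Proof. by rewrite stdpdfE mulr_gt0 ?expR_gt0// normal_peak_gt0// oner_neq0. Qed.

Lemma stdpdfN x : stdpdf (- x) = stdpdf x.
Proof. by rewrite !stdpdfE sqrrN. Qed.

Lemma is_derive_stdpdf x : is_derive x 1 stdpdf (- x * stdpdf x).
Proof.
have -> : stdpdf = (cst (normal_peak 1) * (expR \o (cst (- 2^-1) * (id ^+ 2)))).
  by apply/funext => y; rewrite stdpdfE /= !fctE; congr (_ * expR _); ring.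
have h1 : is_derive x 1 (cst (- 2^-1) * (id ^+ 2)) (- x).
  by apply: is_derive_eq; rewrite /= /GRing.scale/= !fctE; field.
have h2 := is_derive1_comp (is_derive_expR _) h1.
apply: is_derive_eq; rewrite /= /GRing.scale/= !fctE; ring.
Qed.

(** From exp y >= 1 + y; the rate is immaterial. *)
Lemma stdpdf_cvg0 : (fun n : nat => stdpdf n%:R) @ \oo --> 0.
Proof.
have h : (fun n : nat => normal_peak 1 *+ 2 * (n.+1%:R)^-1 : R) @ \oo --> 0.
  rewrite -[X in _ --> X](mulr0 (normal_peak 1 *+ 2)).
  by apply: cvgM; [exact: cvg_cst|exact: cvg_harmonic].
apply: (@squeeze_cvgr _ _ _ _ (cst 0) _ _ _ _ (cvg_cst _) h).
near=> n; rewrite /= (ltW (stdpdf_gt0 _))/= stdpdfE.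
rewrite mulrnAl -mulrnAr ler_wpM2l ?normal_peak_ge0// mulNr expRN.
have -> : n.+1%:R^-1 *+ 2 = (n.+1%:R / 2)^-1 :> R.
  by rewrite invfM invrK mulr_natr.
rewrite lef_pV2 ?posrE ?expR_gt0 ?divr_gt0 ?ltr0n//.
apply: le_trans (expR_ge1Dx _); have : n%:R <= n%:R ^+ 2 + 1 :> R.
  by have := sqr_ge0 (n%:R - 1 : R); have := ler0n R n; nra.
by rewrite -natr1; nra.
Unshelve. all: by end_near. Qed.

Lemma bounded_stdpdf_cvg0 v B : (forall x, `|v x| <= B) ->
  (fun n : nat => v n%:R * stdpdf n%:R) @ \oo --> 0.
Proof.
move=> vB; apply/norm_cvg0P.
have h : (fun n : nat => B * stdpdf n%:R) @ \oo --> 0.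
  rewrite -[X in _ --> X](mulr0 B).
  by apply: cvgM; [exact: cvg_cst|exact: stdpdf_cvg0].
apply: (@squeeze_cvgr _ _ _ _ (cst 0) _ _ _ _ (cvg_cst _) h).
near=> n; rewrite /= normr_ge0/= normrM (gtr0_norm (stdpdf_gt0 _)).
by rewrite ler_wpM2r// ltW// stdpdf_gt0.
Unshelve. all: by end_near. Qed.

(** If x0 v(x0) > K with x0 > 0, put b = K / x0.  The derivative of
    (v - b) stdpdf is (v' - x v + x b) stdpdf, which is nonnegative on
    [x0, +oo) since x b >= K there.  So (v - b) stdpdf stays above its positive
    value at x0, although it tends to 0 along the integers. *)
Lemma stein_ode_le v v' K : (forall x, is_derive x 1 v (v' x)) ->
  (forall x, `|v' x - x * v x| <= K) ->
  (fun n : nat => v n%:R * stdpdf n%:R) @ \oo --> 0 ->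
  forall x, 0 < x -> x * v x <= K.
Proof.
move=> vd vK v0 x0 x0_gt0; rewrite leNgt; apply/negP => Klt.
pose b := K / x0; pose q := (v - cst b) * stdpdf.
have qd x : is_derive x 1 q ((v' x - x * v x + x * b) * stdpdf x).
  have := vd x; have := is_derive_stdpdf x => ? ?.
  apply: is_derive_eq; rewrite /= /GRing.scale/= !fctE; ring.
have K0 : 0 <= K by apply: le_trans (vK 0).
have qd0 x : x0 <= x -> 0 <= (v' x - x * v x + x * b) * stdpdf x.
  move=> xx0; rewrite mulr_ge0 ?(ltW (stdpdf_gt0 _))//.
  have : K <= x * b.
    by rewrite /b mulrCA ler_peMr// ler_pdivlMr// mul1r.
  by have := vK x; rewrite ler_norml => /andP[]; lra.
have q0 : 0 < q x0.
  by rewrite /q !fctE mulr_gt0 ?stdpdf_gt0// subr_gt0 /b ltr_pdivrMr// mulrC.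
have qcvg : (fun n : nat => q n%:R) @ \oo --> 0.
  have -> : (fun n : nat => q n%:R) =
      (fun n => v n%:R * stdpdf n%:R - b * stdpdf n%:R).
    by apply/funext => n; rewrite /q !fctE; ring.
  rewrite -[X in _ --> X](subr0 0); apply: cvgB => //.
  rewrite -[X in _ --> X](mulr0 b).
  by apply: cvgM; [exact: cvg_cst|exact: stdpdf_cvg0].
have := cvgr_lt _ qcvg _ q0.
move=> [N _ NP].
have /NP : (N <= maxn N (Num.bound x0))%N by rewrite leq_maxl.
apply/negP; rewrite -leNgt; apply: (ge0_deriv_le qd qd0).
apply: ltW; apply: lt_le_trans (archi_boundP (ltW x0_gt0)) _.
by rewrite ler_nat leq_maxr.
Qed.

(** The one-sided bound applies to v and -v on the positive half-line, and the
    reflected function x |-> v (- x) satisfies the same hypotheses, which takes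
    care of the negative half-line. *)
Lemma stein_ode_bound v v' K : (forall x, is_derive x 1 v (v' x)) ->
  (forall x, `|v' x - x * v x| <= K) ->
  (fun n : nat => v n%:R * stdpdf n%:R) @ \oo --> 0 ->
  (fun n : nat => v (- n%:R) * stdpdf n%:R) @ \oo --> 0 ->
  forall x, `|x * v x| <= K.
Proof.
have pos v1 v1' : (forall x, is_derive x 1 v1 (v1' x)) ->
    (forall x, `|v1' x - x * v1 x| <= K) ->
    (fun n : nat => v1 n%:R * stdpdf n%:R) @ \oo --> 0 ->
    forall x, 0 < x -> `|x * v1 x| <= K.
  move=> vd vK v0 x x0; rewrite ler_norml lerNl -mulrN.
  rewrite (stein_ode_le vd)// andbT.
  have vNd (y : R) : is_derive y 1 (- v1) (- v1' y).
    by have ? := vd y; apply: is_derive_eq.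
  apply: (stein_ode_le vNd) => // [y|]; first by rewrite !fctE mulrN -opprD normrN.
  have -> : (fun n : nat => (- v1) n%:R * stdpdf n%:R) =
      (fun n : nat => - (v1 n%:R * stdpdf n%:R)).
    by apply/funext => n; rewrite !fctE mulNr.
  by rewrite -[X in _ --> X]oppr0; exact: cvgN.
move=> vd vK vp vn x.
have [x0|x0|->] := ltgtP x 0; last by rewrite mul0r normr0; apply: le_trans (vK 0).
  have xN : 0 < - x by rewrite oppr_gt0.
  have := pos (v \o -%R) (fun y => - v' (- y)) _ _ _ _ xN.
  rewrite /= opprK mulNr normrN; apply => // y.
    exact: is_derive_reflect.
  by have := vK (- y); rewrite mulNr opprK -normrN opprD; congr (`|_| <= _); ring.
exact: pos vd vK vp _ x0.
Qed.

End calculus.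

(** * Maximum principle *)

Section calculus2.
Variable R : realType.
Implicit Types (f v w g p : R -> R) (x y z t s c d a b B K L M C : R).

(** If d > 0, the difference quotients of p' at c make p' positive just to the
    right of c, and p would increase there. *)
Lemma local_max_deriv2_le0 p p' d c : (forall x, is_derive x 1 p (p' x)) ->
  is_derive c 1 p' d -> p' c = 0 -> (forall x, p x <= p c) -> d <= 0.
Proof.
move=> pd [dp' <-] p'c pmax; rewrite leNgt; apply/negP => d0.
have h : (fun h : R => h^-1 *: ((p' \o shift c) (h *: 1) - p' c)) @ 0^'+
           --> 'D_1 p' c.
  exact: cvg_dnbhs_at_right dp'.
have := cvgr_gt _ h _ d0.
move=> [e /= e0 eP].
have ce : c < c + e / 2 by rewrite ltrDl divr_gt0.
have [|y /[!in_itv]/= /andP[cy ye] E] := MVT ce (fun x _ => pd x).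
  exact: is_derive_within pd.
have : 0 < (y - c)^-1 *: (p' (y - c + c) - p' c).
  have := eP (y - c); rewrite /= /GRing.scale/= mulr1; apply.
    by rewrite sub0r normrN gtr0_norm ?subr_gt0//; lra.
  by rewrite subr_gt0.
rewrite subrK p'c subr0 /GRing.scale/= pmulr_rgt0 ?invr_gt0 ?subr_gt0// => p'y.
have : 0 < p' y * (c + e / 2 - c) by rewrite mulr_gt0// subr_gt0.
by rewrite -E subr_gt0 ltNge pmax.
Qed.

(** Subtracting e x^2 from the bounded function w forces the maximum to be
    attained, at some c.  There w1 c = 2 e c and w2 c <= 2 e, so the differential
    inequality bounds w c by M / 2 + e; let e tend to 0. *)
Lemma max_principle_ub w w1 w2 M B : (forall x, is_derive x 1 w (w1 x)) ->
  (forall x, is_derive x 1 w1 (w2 x)) -> (forall x, `|w x| <= B) ->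
  (forall x, - M <= w2 x - x * w1 x - 2 * w x) -> forall x, w x <= M / 2.
Proof.
move=> wd w1d wB wM x.
suff H (e : R) : 0 < e -> w x <= M / 2 + e * (1 + x ^+ 2).
  apply/ler_addgt0Pr => e e0.
  have x2 : 0 < 1 + x ^+ 2 by rewrite ltr_pwDl// sqr_ge0.
  by apply: le_trans (H (e / (1 + x ^+ 2)) _) _; rewrite ?divr_gt0// divfK ?gt_eqF.
move=> e0; pose p := w - cst e * id ^+ 2.
have pE y : p y = w y - e * y ^+ 2 by [].
pose p1 := w1 - cst (2 * e) * id.
have pd (y : R) : is_derive y 1 p (p1 y).
  have ? := wd y; apply: is_derive_eq.
  by rewrite /p1 /= /GRing.scale/= ?fctE; ring.
have p1d (y : R) : is_derive y 1 p1 (w2 y - 2 * e).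
  have ? := w1d y; apply: is_derive_eq.
  by rewrite /= /GRing.scale/= ?fctE; ring.
have B0 : 0 <= B by apply: le_trans (wB 0).
(* Outside [-N, N] one has e y^2 >= 2 B, hence p y <= - B <= p 0. *)
pose N := 1 + 2 * B / e.
have N1 : 1 <= N by rewrite lerDl divr_ge0// ?mulr_ge0// ltW.
have [||c /[!in_itv]/= cN cmax] := @EVT_max R p (- N) N.
- by lra.
- exact: is_derive_within pd.
have pmax y : p y <= p c.
  have [yN|/negP yN] := boolP (- N <= y <= N); first by apply: cmax; rewrite in_itv.
  apply: (@le_trans _ _ (p 0)); last by apply: cmax; rewrite in_itv/=; lra.
  have Ny : N ^+ 2 <= y ^+ 2.
    rewrite -[leRHS]real_normK ?num_real// ler_sqr ?nnegrE//; last by lra.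
    rewrite leNgt; apply/negP => /ltW; rewrite ler_norml; exact: yN.
  have : 2 * B <= e * y ^+ 2.
    rewrite -ler_pdivrMl//; apply: le_trans Ny.
    have : N <= N ^+ 2 by rewrite ler_eXnr.
    by rewrite {1}/N [_^-1 * _]mulrC; lra.
  have := wB 0; have := wB y; rewrite !ler_norml !pE expr0n/= mulr0.
  by move=> /andP[? ?] /andP[? ?]; lra.
have p1c : p1 c = 0.
  have cc : c \in `](c - 1), (c + 1)[%R by rewrite in_itv/=; lra.
  have [||_ <-] := derive1_at_max (_ : c - 1 <= c + 1) _ cc (fun t _ => pmax t).
  - by lra.
  - by move=> t _; have [] := pd t.
  by have [_ ->] := pd c.
have := local_max_deriv2_le0 pd (p1d c) p1c pmax.
move: p1c (pmax x) (wM c); rewrite !pE /p1 !fctE => p1c.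
have -> : w1 c = 2 * e * c by lra.
have := mulr_ge0 (ltW e0) (sqr_ge0 c).
lra.
Qed.

Lemma max_principle w w1 w2 M B : (forall x, is_derive x 1 w (w1 x)) ->
  (forall x, is_derive x 1 w1 (w2 x)) -> (forall x, `|w x| <= B) ->
  (forall x, `|w2 x - x * w1 x - 2 * w x| <= M) -> forall x, `|w x| <= M / 2.
Proof.
move=> wd w1d wB wM x; rewrite ler_norml lerNl; apply/andP; split.
  apply: (@max_principle_ub (- w) (- w1) (- w2) M B).
  - by move=> y; rewrite normrN.
  - by move=> y; have := wM y; rewrite ler_norml !fctE => /andP[]; lra.
apply: (max_principle_ub wd w1d wB) => y.
by have := wM y; rewrite ler_norml => /andP[].
Qed.

(** * Taylor bounds *)

Lemma integrate_power_le p p' C k : (forall x, is_derive x 1 p (p' x)) ->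
  p 0 = 0 -> (forall t, 0 <= t -> p' t <= C * t ^+ k) ->
  forall t, 0 <= t -> p t <= C / k.+1%:R * t ^+ k.+1.
Proof.
move=> pd p0 p'C t t0.
pose q := cst (C / k.+1%:R) * id ^+ k.+1 - p.
have qd x : is_derive x 1 q (C * x ^+ k - p' x).
  have ? := pd x; apply: is_derive_eq.
  by rewrite /= /GRing.scale/= !fctE; field; rewrite addrC natr1 pnatr_eq0.
have := ge0_deriv_le qd _ t0.
rewrite /q !fctE p0 expr0n/= mulr0 subrr subr_ge0; apply => x x0.
by rewrite subr_ge0 p'C.
Qed.

(** Iterated, this gives the Taylor remainders from a bound on the last
    derivative alone, by monotonicity instead of an integral formula. *)
Lemma integrate_power_bound p p' C k : (forall x, is_derive x 1 p (p' x)) ->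
  p 0 = 0 -> (forall t, `|p' t| <= C * `|t| ^+ k) ->
  forall t, `|p t| <= C / k.+1%:R * `|t| ^+ k.+1.
Proof.
move=> pd p0 p'C.
have pos f f' : (forall x, is_derive x 1 f (f' x)) -> f 0 = 0 ->
    (forall t, `|f' t| <= C * `|t| ^+ k) ->
    forall t, 0 <= t -> `|f t| <= C / k.+1%:R * `|t| ^+ k.+1.
  move=> fd f0 fC t t0; rewrite (ger0_norm t0) ler_norml lerNl; apply/andP; split.
    apply: (@integrate_power_le (- f) (- f')) => //.
    - by rewrite fctE f0 oppr0.
    - move=> y y0; have := fC y; rewrite (ger0_norm y0) ler_norml !fctE.
      by move=> /andP[]; lra.
  apply: (integrate_power_le fd) => // y y0; have := fC y.
  by rewrite (ger0_norm y0) ler_norml => /andP[].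
move=> t; have [t0|/ltW t0] := leP 0 t; first exact: pos pd _ _ _ _.
have tN : 0 <= - t by rewrite oppr_ge0.
have := pos (p \o -%R) (fun y => - p' (- y)) _ _ _ _ tN.
rewrite /= opprK normrN; apply => [y||y].
- exact: is_derive_reflect.
- by rewrite oppr0.
- by rewrite normrN -[`|y|]normrN.
Qed.

Lemma is_derive_shift f d s t : is_derive (s + t) 1 f d ->
  is_derive t 1 (fun t => f (s + t)) d.
Proof.
move=> fd.
have h : is_derive t 1 (cst s + id) 1 by apply: is_derive_eq; rewrite add0r.
by have := is_derive1_comp (fd : is_derive ((cst s + id) t) 1 f d) h; rewrite mulr1.
Qed.

Lemma taylor1 f f1 f2 L s t : (forall x, is_derive x 1 f (f1 x)) ->
  (forall x, is_derive x 1 f1 (f2 x)) -> (forall x, `|f2 x| <= L) ->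
  `|f (s + t) - f s - t * f1 s| <= L / 2 * t ^+ 2.
Proof.
move=> fd f1d f2L.
pose p1 t := f1 (s + t) - f1 s.
have p1d y : is_derive y 1 p1 (f2 (s + y)).
  have ? := is_derive_shift (f1d (s + y)).
  have -> : p1 = (fun t => f1 (s + t)) - cst (f1 s) by [].
  by apply: is_derive_eq; rewrite subr0.
have p1b := integrate_power_bound (C := L) (k := 0) p1d.
pose p t := f (s + t) - f s - t * f1 s.
have pd y : is_derive y 1 p (p1 y).
  have ? := is_derive_shift (fd (s + y)).
  have -> : p = (fun t => f (s + t)) - cst (f s) - id * cst (f1 s) by [].
  by apply: is_derive_eq; rewrite /GRing.scale/= /p1; ring.
have := integrate_power_bound (C := L) (k := 1) pd _ _ t.
rewrite real_normK ?num_real//; apply.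
  by rewrite /p addr0 subrr mul0r subrr.
move=> y; have := p1b _ _ y; rewrite divr1; apply.
  by rewrite /p1 addr0 subrr.
by move=> z; rewrite expr0 mulr1.
Qed.

Lemma taylor2 f f1 f2 f3 L s t : (forall x, is_derive x 1 f (f1 x)) ->
  (forall x, is_derive x 1 f1 (f2 x)) -> (forall x, is_derive x 1 f2 (f3 x)) ->
  (forall x, `|f3 x| <= L) ->
  `|f (s + t) - f s - t * f1 s - t ^+ 2 / 2 * f2 s| <= L / 6 * `|t| ^+ 3.
Proof.
move=> fd f1d f2d f3L.
pose p1 t := f1 (s + t) - f1 s - t * f2 s.
pose p t := f (s + t) - f s - t * f1 s - t ^+ 2 / 2 * f2 s.
have pd y : is_derive y 1 p (p1 y).
  have ? := is_derive_shift (fd (s + y)).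
  have -> : p = (fun t => f (s + t)) - cst (f s) - id * cst (f1 s)
                - id ^+ 2 * cst (2^-1 * f2 s).
    by apply/funext => z; rewrite /p !fctE -mulrA.
  by apply: is_derive_eq; rewrite /GRing.scale/= /p1 !fctE; field.
have := integrate_power_bound (C := L / 2) (k := 2) pd _ _ t.
have -> : L / 2 / 3 = L / 6 by field.
apply.
  by rewrite /p addr0 subrr expr0n/= !mul0r !subr0.
by move=> y; rewrite real_normK ?num_real//; exact: taylor1.
Qed.

End calculus2.

(** * The standard normal distribution *)

Section gaussian.
Variable R : realType.
Implicit Types (f g : R -> R) (x y z t s c d a b B K L M C : R).

Notation mu := (@lebesgue_measure R).
Notation gamma := (normal_prob (0 : R) 1).

(** The density of the normal law agrees almost everywhere with its
    Radon-Nikodym derivative, to which the change of variables applies. *)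
Lemma integral_gaussian (E : set R) (f : R -> \bar R) : measurable E ->
  gamma.-integrable E f ->
  (\int[gamma]_(x in E) f x = \int[mu]_(x in E) (f x * (stdpdf x)%:E))%E.
Proof.
move=> mE fi.
have dom := @normal_prob_dominates R 0 1.
rewrite -(Radon_Nikodym_change_of_variables dom mE fi).
have RNi : mu.-integrable setT (Radon_Nikodym (charge_of_finite_measure gamma) mu).
  exact: Radon_Nikodym_integrable.
have mphi : measurable_fun [set: R] (EFin \o @stdpdf R).
  by apply/measurable_EFinP; exact: measurable_normal_pdf.
have mRN : measurable_fun [set: R]
    (Radon_Nikodym (charge_of_finite_measure gamma) mu).
  exact: measurable_int RNi.
apply: ae_eq_integral => //.
- apply: emeasurable_funM; first exact: measurable_int fi.
  exact: measurable_funTS.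
- apply: emeasurable_funM; first exact: measurable_int fi.
  exact: measurable_funTS.
- apply: ae_eqe_mul2l; apply: integral_ae_eq => //.
  + exact: integrableS RNi.
  + exact: measurable_funTS.
  + by move=> A AE mA; rewrite -Radon_Nikodym_integral.
Qed.


Lemma gaussian_tails_cvg0 :
  (fun n : nat => fine (gamma `]n%:R, +oo[)) @ \oo --> 0 /\
  (fun n : nat => fine (gamma `]-oo, - n%:R])) @ \oo --> 0.
Proof.
pose idRV : {RV gamma >-> R} := mfun_of (@measurable_id _ (measurableTypeR R) setT
  : measurable_fun setT (idfun : measurableTypeR R -> R)).
split.
  have /fine_cvgP[_ h] := @cvg_ccdfy0 _ _ R gamma idRV.
  exact: (cvg_comp _ _ (@cvgr_idn R) h).
have /fine_cvgP[_ h] := @cvg_cdfNy0 _ _ R gamma idRV.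
by apply: (cvg_comp _ _ _ h); rewrite cvgNrNy; exact: cvgr_idn.
Qed.

(** * Stein's equation *)

(** With k = g - c, the solution is f = F / stdpdf, where F x is the integral of
    k against the normal law over (-oo, x].  Centring makes F x also minus the
    integral over (x, +oo), so f stdpdf = F vanishes at both ends with the tails
    of the normal law. *)
Lemma stein_solution_exists g g' B : (forall x, is_derive x 1 g (g' x)) ->
  (forall x, `|g x| <= B) -> let c := \int[gamma]_x g x in
  exists f, [/\ forall x, is_derive x 1 f (g x - c + x * f x),
    (fun n : nat => f n%:R * stdpdf n%:R) @ \oo --> 0 &
    (fun n : nat => f (- n%:R) * stdpdf n%:R) @ \oo --> 0].
Proof.
move=> gd gB c.
have gc x : {for x, continuous g} by exact: is_derive_continuous_at (gd x).
have mg : measurable_fun setT g by exact: continuous_measurable_fun.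
have gi : gamma.-integrable setT (EFin \o g) := bounded_integrable gamma mg gB.
pose k := g - cst c.
have mk : measurable_fun setT k by exact: measurable_funB.
pose Bk := B + `|c|.
have kB x : `|k x| <= Bk by rewrite (le_trans (ler_normB _ _))// lerD.
have ki : gamma.-integrable setT (EFin \o k) := bounded_integrable gamma mk kB.
pose F x := \int[gamma]_(t in `]-oo, x]) k t.
have Fd x : is_derive x 1 F (k x * stdpdf x).
  pose kp t := k t * stdpdf t.
  have FE : F = fun x => \int[mu]_(t in `]-oo, x]) kp t.
    apply/funext => y; rewrite /F /Rintegral integral_gaussian//.
    exact: integrableS ki.
  have kpi : mu.-integrable `]-oo, (x + 1)] (EFin \o kp).
    apply: (@integrableS _ _ _ _ setT) => //.
    have -> : EFin \o kp = ((EFin \o k) \* (fun t => (stdpdf t)%:E))%E.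
      by apply/funext => t; rewrite /= EFinM.
    apply: integrableMr => //; last exact: integrable_normal_pdf.
    by exists Bk; split; [exact: num_real|move=> M BM t _; apply: le_trans (ltW BM)].
  have [] := @continuous_FTC1 R kp -oo%O x (x + 1) _ kpi _ _.
  - by rewrite ltrDl.
  - by rewrite ltNyr.
  - apply: cvgM; first by apply: cvgB; [exact: gc|exact: cvg_cst].
    exact: continuous_normal_pdf.
  - by move=> dF E; rewrite FE; split; [exact: dF|rewrite -derive1E; exact: E].
(* The integral of k over the whole line is 0. *)
have Ftop (n : nat) : F n%:R = - \int[gamma]_(t in `]n%:R, +oo[) k t.
  have : \int[gamma]_t k t = 0.
    exact: (Rintegral_centered (P := gamma) gi).
  have kin : gamma.-integrable (`]-oo, n%:R] `|` `]n%:R, +oo[) (EFin \o k).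
    by apply: integrableS ki => //; exact: measurableU.
  rewrite -(itv_setU_setT false (n%:R : R)) Rintegral_setU//.
    by move=> /eqP; rewrite addr_eq0 => /eqP.
  exact: disjoint_rays.
pose f x := F x / stdpdf x.
have fphi x : f x * stdpdf x = F x by rewrite divfK// gt_eqF// stdpdf_gt0.
have [tp tn] := gaussian_tails_cvg0.
have Bcvg (u : nat -> R) : u @ \oo --> 0 -> (fun n => Bk * u n) @ \oo --> 0.
  by move=> u0; rewrite -[X in _ --> X](mulr0 Bk); apply: cvgM => //; exact: cvg_cst.
exists f; split.
- move=> x; have ? := is_derive_stdpdf x; have ? := Fd x.
  have p0 : stdpdf x != 0 by rewrite gt_eqF ?stdpdf_gt0.
  have ? := is_deriveV p0 (is_derive_stdpdf x).
  have -> : f = F * (fun y => (stdpdf y)^-1) by [].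
  apply: is_derive_eq; rewrite /GRing.scale/= /k /f !fctE; field.
  exact: p0.
- apply/norm_cvg0P/(squeeze_cvgr _ (cvg_cst 0) (Bcvg _ tp)).
  near=> n; rewrite /= normr_ge0 fphi Ftop normrN/=.
  exact: Rintegral_bound.
- apply/norm_cvg0P/(squeeze_cvgr _ (cvg_cst 0) (Bcvg _ tn)).
  near=> n; rewrite /= normr_ge0 -stdpdfN fphi/=.
  exact: Rintegral_bound.
Unshelve. all: by end_near. Qed.

End gaussian.

Section stein_bounds.
Variable R : realType.
Implicit Types (f g : R -> R) (x y z t s c a b B K L M C : R).

Notation gamma := (normal_prob (0 : R) 1).

Lemma bounded_stein_ode_bound v v' B K : (forall x, is_derive x 1 v (v' x)) ->
  (forall x, `|v x| <= B) -> (forall x, `|v' x - x * v x| <= K) ->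
  forall x, `|x * v x| <= K.
Proof.
move=> vd vB vK; apply: (stein_ode_bound vd vK); first exact: bounded_stdpdf_cvg0 vB.
have -> : (fun n : nat => v (- n%:R) * stdpdf n%:R) =
    (fun n : nat => (v \o -%R) n%:R * stdpdf n%:R) by [].
by apply: bounded_stdpdf_cvg0 => x; exact: vB.
Qed.

(** Each f_i is the formal derivative of the previous one, computed from
    Stein's equation.  Qualitative bounds come first, in the order x f, f1, f,
    x f1, f2, as the comparison and maximum principles need functions known to
    be bounded; the bounds by M follow from these principles. *)
Lemma stein_solution g g' g'' B B1 M : (forall x, is_derive x 1 g (g' x)) ->
  (forall x, is_derive x 1 g' (g'' x)) -> (forall x, `|g x| <= B) ->
  (forall x, `|g' x| <= B1) -> (forall x, `|g'' x| <= M) ->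
  exists f f1 f2 f3 K,
    [/\ forall x, is_derive x 1 f (f1 x), forall x, is_derive x 1 f1 (f2 x),
        forall x, is_derive x 1 f2 (f3 x) &
    [/\ forall x, f1 x - x * f x = g x - \int[gamma]_y g y,
        forall x, `|f1 x| <= K & forall x, `|f3 x| <= 4 * M]].
Proof.
move=> gd g'd gB gB1 gM; set c := \int[gamma]_y g y.
have [f [+ ftop fbot]] := stein_solution_exists gd gB.
rewrite -/c => fd; clearbody c.
pose f1 x := g x - c + x * f x.
pose f2 x := g' x + f x + x * f1 x.
pose f3 x := g'' x + 2 * f1 x + x * f2 x.
have f1d x : is_derive x 1 f1 (f2 x).
  have -> : f1 = g - cst c + id * f by [].
  apply: (is_derive_eq (is_deriveD (is_deriveB (gd x) (is_derive_cst c x 1))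
    (is_deriveM (is_derive_id x 1) (fd x)))).
  by rewrite /GRing.scale/= /f2 /f1; ring.
have f2d x : is_derive x 1 f2 (f3 x).
  have -> : f2 = g' + f + id * f1 by [].
  apply: (is_derive_eq (is_deriveD (is_deriveD (g'd x) (fd x))
    (is_deriveM (is_derive_id x 1) (f1d x)))).
  by rewrite /GRing.scale/= /f3 /f2 /f1; ring.
pose K0 := B + `|c|.
have K00 : 0 <= K0 by rewrite addr_ge0// (le_trans _ (gB 0)).
have xf x : `|x * f x| <= K0.
  apply: (stein_ode_bound fd) => // y.
  by rewrite addrK (le_trans (ler_normB _ _))// lerD.
have f1B x : `|f1 x| <= K0 + K0.
  rewrite (le_trans (ler_normD _ _))// lerD// (le_trans (ler_normB _ _))//.
  by rewrite lerD.
(* From |x f x| <= K0 away from 0, and from the bound on f1 near 0. *)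
have fbd x : `|f x| <= `|f 0| + 3 * K0.
  have [x1|x1] := leP `|x| 1.
    have := lipschitz_of_bounded_deriv fd f1B 0 x; rewrite subr0.
    have : `|f x| <= `|f 0| + `|f x - f 0|.
      by rewrite -{1}(subrK (f 0) (f x)) addrC ler_normD.
    by have := normr_ge0 x; nra.
  have := xf x; rewrite normrM; have := normr_ge0 (f x).
  by have := normr_ge0 (f 0); nra.
have xf1 x : `|x * f1 x| <= B1 + (`|f 0| + 3 * K0).
  apply: (bounded_stein_ode_bound f1d f1B) => y.
  by rewrite addrK (le_trans (ler_normD _ _))// lerD.
have f2B x : `|f2 x| <= 2 * (B1 + (`|f 0| + 3 * K0)).
  rewrite mulr_natl mulr2n (le_trans (ler_normD _ _))// lerD//.
  by rewrite (le_trans (ler_normD _ _))// lerD.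
(* Differentiating twice, f1 solves w'' - x w' - 2 w = g''. *)
have f1M : forall x, `|f1 x| <= M / 2.
  apply: (max_principle f1d f2d f1B) => y.
  by rewrite /f3 addrK addrK.
have kM x : `|g'' x + 2 * f1 x| <= 2 * M.
  rewrite (le_trans (ler_normD _ _))// normrM normr_nat.
  by have := gM x; have := f1M x; lra.
have xf2 x : `|x * f2 x| <= 2 * M.
  apply: (bounded_stein_ode_bound f2d f2B) => y.
  by rewrite addrK.
exists f, f1, f2, f3, (M / 2); split => //; split => // x.
  by rewrite /f1 addrK.
rewrite (le_trans (ler_normD _ _))//.
by have := kM x; have := xf2 x; lra.
Qed.

End stein_bounds.

(** * Second moment of the standard normal distribution *)

Section gaussian_variance.
Variable R : realType.
Implicit Types (f g : R -> R) (x y z t s c a b B K L M C : R).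

Notation mu := (@lebesgue_measure R).
Notation gamma := (normal_prob (0 : R) 1).

(** The function z |-> z * stdpdf z has derivative (1 - z^2) * stdpdf z.  Its
    increment over [-N, N] is nonnegative, so the truncated second moment is at
    most the mass of [-N, N]. *)
Lemma gaussian_truncated_second_moment (N : R) : 0 < N ->
  (\int[gamma]_(z in `[(- N)%R, N]) (z ^+ 2)%:E <= 1)%E.
Proof.
move=> N0; set I := `[- N, N]%classic.
have cphi : continuous (@stdpdf R) by move=> x; exact: is_derive_continuous_at (is_derive_stdpdf x).
have c2 : continuous (fun z : R => z ^+ 2) by exact: sqr_continuous.
have c2phi : continuous (fun z : R => z ^+ 2 * stdpdf z).
  by move=> z; apply: cvgM; [exact: c2|exact: cphi].
have ci f : continuous f -> mu.-integrable I (EFin \o f).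
  move=> cf; apply: continuous_compact_integrable; first exact: segment_compact.
  exact: continuous_subspaceT.
have m2 : measurable_fun [set: R] (fun z : R => z ^+ 2).
  exact: continuous_measurable_fun.
have i2 : gamma.-integrable I (EFin \o (fun z : R => z ^+ 2)).
  apply: (bounded_integrable_on gamma (B := N ^+ 2)) => //.
    exact: measurable_itv.
  move=> x; rewrite /I/= in_itv/= => xN.
  by rewrite normrX ler_sqr ?nnegrE ?(ltW N0)// ler_norml.
pose F := id * @stdpdf R.
have Fd x : is_derive x 1 F (stdpdf x - x ^+ 2 * stdpdf x).
  have ? := is_derive_stdpdf x.
  by apply: is_derive_eq; rewrite /GRing.scale/= ?fctE; ring.
have NN : - N < N by lra.
have E : (\int[mu]_(x in I) (stdpdf x - x ^+ 2 * stdpdf x)%:E = (F N)%:E - (F (- N))%:E)%E.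
  apply: continuous_FTC2 => //.
  - by apply: continuous_subspaceT => z; apply: cvgB; [exact: cphi|exact: c2phi].
  - split.
    + by move=> x _; have [] := Fd x.
    + apply: cvg_at_right_filter; exact: is_derive_continuous_at (Fd _).
    + apply: cvg_at_left_filter; exact: is_derive_continuous_at (Fd _).
  - by move=> x _; rewrite derive1E; have [_ ->] := Fd x.
have mI : measurable (I : set (measurableTypeR R)) by exact: measurable_itv.
have qE : (\int[gamma]_(z in I) (z ^+ 2)%:E = (\int[mu]_(z in I) (z ^+ 2 * stdpdf z))%:E)%E.
  rewrite (integral_gaussian mI i2) /Rintegral fineK.
    by apply: eq_integral => z _; rewrite EFinM.
  exact: integrable_fin_num (ci _ c2phi).
have p1 : \int[mu]_(z in I) stdpdf z <= 1.
  rewrite -lee_fin /Rintegral fineK; last exact: integrable_fin_num (ci _ cphi).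
  exact: (@probability_le1 _ _ R gamma I).
have := RintegralB mI (ci _ cphi) (ci _ c2phi).
rewrite [X in X = _](_ : _ = F N - F (- N)); last by rewrite /Rintegral E.
rewrite qE lee_fin /F !fctE stdpdfN => E2.
have : 0 <= N * stdpdf N by rewrite mulr_ge0// ltW// stdpdf_gt0.
by move: E2 p1; lra.
Qed.

Lemma gaussian_second_moment : (\int[gamma]_z (z ^+ 2)%:E <= 1)%E.
Proof.
pose I (n : nat) : set R := `[- n.+1%:R, n.+1%:R].
have IT : \bigcup_n I n = setT.
  apply/seteqP; split => // x _; exists (Num.bound `|x|) => //.
  rewrite /I/= in_itv/= -ler_norml (le_trans (ltW (archi_boundP _)))//.
  by rewrite ler_nat.
have mf : measurable_fun setT (fun z : measurableTypeR R => ((z : R) ^+ 2)%:E).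
  by apply/measurable_EFinP; apply: continuous_measurable_fun; exact: sqr_continuous.
have h : (\int[gamma]_(z in I i) (z ^+ 2)%:E)%E @[i --> \oo] -->
    (\int[gamma]_(z in \bigcup_i I i) (z ^+ 2)%:E)%E.
  apply: ge0_nondecreasing_set_cvg_integral.
  - move=> i j ij; rewrite subsetEset => x; rewrite /I/= !in_itv/= -!ler_norml.
    by move=> /le_trans; apply; rewrite ler_nat.
  - by move=> i; exact: measurable_itv.
  - by move=> i; exact: measurable_funTS.
  - by move=> i x _; rewrite lee_fin sqr_ge0.
rewrite -IT; apply: (cvge_to_le h).
by apply: nearW => n; exact: gaussian_truncated_second_moment.
Qed.

End gaussian_variance.

(** * Independence of block sums *)

Section independence_extension.
Local Open Scope ereal_scope.
Context (d : measure_display) (T : measurableType d) (R : realType).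
Variable P : probability T R.
Implicit Types (G : set (set T)) (A B D : set T).

(** A |-> P (A `&` D) and A |-> P A * P D are finite measures that agree on the
    pi-system G. *)
Lemma indep_g_sigma_algebra G D : G `<=` measurable -> setI_closed G ->
  G setT -> measurable D -> (forall A, G A -> P (A `&` D) = P A * P D) ->
  forall A, <<s G >> A -> P (A `&` D) = P A * P D.
Proof.
move=> Gm GI GT mD GD A sA.
have PD0 : (0 <= fine (P D))%R by rewrite fine_ge0.
pose m1 := mrestr P mD.
pose m2 := mscale (NngNum PD0) P.
have m2E B : m2 B = P B * P D.
  by rewrite /m2 /mscale/= fineK ?fin_num_measure// muleC.
have := @g_sigma_algebra_measure_unique _ R T G Gm (fun=> setT) (fun=> GT) _ m1 m2 GI.
rewrite -m2E; apply => //.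
- by rewrite -subTset => x _; exists 0%N.
- by move=> B GB; exact: etrans (GD B GB) (esym (m2E B)).
- by move=> _; rewrite /m1 /mrestr (le_lt_trans (probability_le1 _ _)) ?ltry//; exact: measurableI.
Qed.

Lemma indep_g_sigma_algebra2 G1 G2 :
  G1 `<=` measurable -> setI_closed G1 -> G1 setT ->
  G2 `<=` measurable -> setI_closed G2 -> G2 setT ->
  (forall A B, G1 A -> G2 B -> P (A `&` B) = P A * P B) ->
  forall A B, <<s G1 >> A -> <<s G2 >> B -> P (A `&` B) = P A * P B.
Proof.
move=> m1 I1 T1 m2 I2 T2 G12 A B sA sB.
have mB : measurable B by exact: (smallest_sub (@sigma_algebra_measurable _ T) m2).
apply: (indep_g_sigma_algebra m1) => // {sA}A GA.
rewrite setIC muleC; apply: (indep_g_sigma_algebra m2) => //; first exact: m1.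
by move=> C GC; rewrite setIC muleC G12.
Qed.

End independence_extension.

Section cylinders.
Context (d : measure_display) (T : measurableType d) (R : realType).
Variables (P : probability T R) (I : finType) (X : I -> {RV P >-> R}).
Implicit Types (J : {set I}) (A : I -> set R).

(** The cylinders over J generate the sigma-algebra of the variables with index
    in J and form a pi-system, on which mutual independence can be read off. *)
Definition cylinder J A : set T := \bigcap_(i in [set` J]) X i @^-1` A i.

Definition cylinders J : set (set T) :=
  [set C | exists2 A, (forall i, measurable (A i)) & C = cylinder J A].

Lemma cylinder_measurable J : cylinders J `<=` measurable.
Proof.
move=> _ [A mA ->]; apply: fin_bigcap_measurable => // i _.
by rewrite -[X in measurable X]setTI; exact: measurable_funP.
Qed.

Lemma cylindersI J : setI_closed (cylinders J).
Proof.
move=> _ _ [A mA ->] [B mB ->]; exists (fun i => A i `&` B i).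
  by move=> i; exact: measurableI.
rewrite /cylinder; apply/seteqP; split => [x [xA xB] i iJ|x xAB].
  by split; [exact: xA|exact: xB].
by split => i iJ; have [] := xAB i iJ.
Qed.

Lemma cylindersT J : cylinders J setT.
Proof.
exists (fun=> setT) => //; rewrite /cylinder; apply/seteqP; split => //.
Qed.

Hypothesis indep : mutually_independent X.

Lemma cylinders_indep J1 J2 : [disjoint J1 & J2]%B ->
  forall C1 C2, cylinders J1 C1 -> cylinders J2 C2 ->
  P (C1 `&` C2) = (P C1 * P C2)%E.
Proof.
move=> J12 _ _ [A mA ->] [B mB ->].
pose D i := if i \in J1 then A i else B i.
have mD i : measurable (D i) by rewrite /D; case: ifP.
have J2N i : i \in J2 -> (i \in J1) = false.
  by move=> iJ2; apply/negbTE; rewrite (disjointFl J12).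
have -> : cylinder J1 A `&` cylinder J2 B = cylinder (J1 :|: J2) D.
  apply/seteqP; split => [x [xA xB] i /=|x xD].
    rewrite inE /D; case: ifPn => [iJ1 _|_ /= iJ2]; first exact: xA.
    exact: xB.
  split => i /= iJ.
    by have := xD i; rewrite /D /= inE iJ; apply.
  by have := xD i; rewrite /D /= inE iJ J2N// orbT; apply.
rewrite /cylinder !indep//.
rewrite (eq_bigl [predU J1 & J2]) => [|i]; last by rewrite !inE.
rewrite bigU/=; last exact: J12.
by congr (_ * _)%E; apply: eq_bigr => i iJ; rewrite /D ?iJ// J2N.
Qed.

(** The sum is measurable on T equipped with the sigma-algebra generated by the
    cylinders over J. *)
Lemma measurable_block_sum J (a : R) (E : set R) : measurable E ->
  <<s cylinders J >> ((fun w => a * \sum_(i in J) X i w) @^-1` E).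
Proof.
move=> mE.
have mX i : i \in J ->
    measurable_fun setT (X i : g_sigma_algebraType (cylinders J) -> R).
  move=> iJ _ A mA; rewrite setTI; apply: sub_sigma_algebra.
  exists (fun k => if k == i then A else setT).
    by move=> k; case: ifP.
  rewrite /cylinder; apply/seteqP; split => [x xA k _|x /(_ i iJ)].
    by case: eqP => // ->.
  by rewrite eqxx.
have : measurable_fun setT
    ((fun w => a * \sum_(i in J) X i w) : g_sigma_algebraType (cylinders J) -> R).
  apply: measurable_funM => //.
  under eq_fun do rewrite big_mkcond.
  apply: measurable_sum => i; case: (boolP (i \in J)) => [/mX//|_].
  exact: measurable_cst.
by move=> /(_ measurableT E mE); rewrite setTI.
Qed.

Lemma block_sums_indep J1 J2 (a1 a2 : R) (E1 E2 : set R) : [disjoint J1 & J2]%B ->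
  measurable E1 -> measurable E2 ->
  let S1 := fun w => a1 * \sum_(i in J1) X i w in
  let S2 := fun w => a2 * \sum_(i in J2) X i w in
  P (S1 @^-1` E1 `&` S2 @^-1` E2) = (P (S1 @^-1` E1) * P (S2 @^-1` E2))%E.
Proof.
move=> J12 mE1 mE2 S1 S2.
apply: (@indep_g_sigma_algebra2 _ _ _ _ (cylinders J1) (cylinders J2));
  try exact: cylinder_measurable; try exact: cylindersI; try exact: cylindersT;
  try exact: measurable_block_sum.
exact: cylinders_indep.
Qed.

End cylinders.

Section independent_pairs.
Context (d : measure_display) (T : measurableType d) (R : realType).
Variables (P : probability T R) (A B : {mfun T >-> R}).

Definition indep_pair := forall E F : set R, measurable E -> measurable F ->
  P (A @^-1` E `&` B @^-1` F) = (P (A @^-1` E) * P (B @^-1` F))%E.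

(** The joint law of an independent pair is the product of the marginals, so
    this is Fubini's theorem.  Integrability for every s, and not only for
    almost every s, makes the inner real-valued integral meaningful. *)
Lemma integral_indep_pair (g : R * R -> R) : indep_pair ->
  measurable_fun setT g ->
  P.-integrable setT (fun w => (g (A w, B w))%:E) ->
  (forall s, (distribution P A).-integrable setT (fun x => (g (x, s))%:E)) ->
  measurable_fun setT (fun s => \int[distribution P A]_x g (x, s)) /\
  \int[P]_w g (A w, B w) =
  \int[distribution P B]_s \int[distribution P A]_x g (x, s).
Proof.
move=> AB mg gi gsi.
have mAB : measurable_fun setT (fun w => (A w, B w)).
  by apply: measurable_fun_pair; exact: measurable_funP.
pose AB' : {mfun T >-> (R * R)%type} := mfun_of mAB.
have mg' : measurable_fun setT (EFin \o g) by exact/measurable_EFinP.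
have lawE X : measurable X ->
    (distribution P A \x distribution P B)%E X = distribution P AB' X.
  by apply: product_measure_unique => E F mE mF; rewrite -AB.
have gi' : (distribution P AB').-integrable setT (EFin \o g).
  exact: integrable_pushforward.
have lawI : (distribution P A \x distribution P B)%E.-integrable setT (EFin \o g).
  apply/integrableP; split => //; move/integrableP: gi' => [_].
  rewrite (_ : integral _ _ _ =
      (\int[(distribution P A \x distribution P B)%E]_z `|(EFin \o g) z|)%E)//.
  by apply: eq_measure_integral => X mX _; exact/esym/lawE.
have fin s : (\int[distribution P A]_x (g (x, s))%:E)%E =
    (\int[distribution P A]_x g (x, s))%:E.
  by rewrite fineK//; exact: integrable_fin_num.
split.
  apply/measurable_EFinP; rewrite (_ : EFin \o _ =
      fubini_G (distribution P A) (EFin \o g)); first exact: measurable_fubini_G lawI.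
  by apply/funext => s; rewrite /= -fin.
have -> : \int[P]_w g (A w, B w) = \int[distribution P AB']_z g z.
  congr fine; exact/esym/integral_distribution.
rewrite [RHS]/Rintegral; under eq_integral do rewrite -fin.
rewrite (integral21_prod_meas1 lawI).
congr fine; apply: eq_measure_integral => X mX _; exact/esym/lawE.
Qed.

End independent_pairs.

(** * Expansion in one summand *)

Section standardized_law.
Variable R : realType.
Variable mu : probability R R.
Implicit Types (x s a b c L K : R) (f : R -> R).

Hypothesis mu4 : mu.-integrable setT (fun x => (x ^+ 4)%:E).
Hypothesis mean0 : \int[mu]_x x = 0.
Hypothesis var1 : \int[mu]_x (x ^+ 2) = 1.
Hypothesis third0 : \int[mu]_x (x ^+ 3) = 0.
Let m4 := \int[mu]_x (x ^+ 4).

Lemma power_le_fourth k x : (k <= 4)%N -> `|x| ^+ k <= 1 + x ^+ 4.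
Proof.
move=> kle; have x4 : x ^+ 4 = `|x| ^+ 4 by rewrite -normrX ger0_norm// exprn_even_ge0.
have [x1|/ltW x1] := leP `|x| 1.
  apply: (@le_trans _ _ 1); first exact: exprn_ile1.
  by rewrite lerDl x4 exprn_ge0.
by apply: (@le_trans _ _ (`|x| ^+ 4)); [exact: ler_weXn2l|rewrite x4 lerDr].
Qed.

Lemma powers_integrable k : (k <= 4)%N -> mu.-integrable setT (fun x => (x ^+ k)%:E).
Proof.
move=> kle; apply: (@integrable_dominated R _ _ mu (fun x => x ^+ k) (fun x => 1 + x ^+ 4)).
- exact: exprn_measurable.
- rewrite (_ : EFin \o _ = (fun x => 1%:E + (x ^+ 4)%:E)%E)//.
  by apply: integrableD => //; exact: finite_measure_integrable_cst.
- by move=> x; rewrite normrX; exact: power_le_fourth.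
Qed.

(** The first and third moments vanish and the second is 1. *)
Lemma quartic_integral c0 c1 c2 c3 c4 :
  let p x := c0 + c1 * x + c2 * x ^+ 2 + c3 * x ^+ 3 + c4 * x ^+ 4 in
  mu.-integrable setT (EFin \o p) /\ \int[mu]_x p x = c0 + c2 + c4 * m4.
Proof.
move=> p.
have ic k c : (k <= 4)%N -> mu.-integrable setT (EFin \o (fun x => c * x ^+ k)).
  move=> kle; rewrite (_ : EFin \o _ = (fun x => c%:E * (x ^+ k)%:E)%E)//.
  exact/integrableZl/powers_integrable.
have Ic k c : (k <= 4)%N -> \int[mu]_x (c * x ^+ k) = c * \int[mu]_x (x ^+ k).
  by move=> kle; rewrite RintegralZl//; exact: powers_integrable.
have i0 : mu.-integrable setT (EFin \o cst c0) by exact: finite_measure_integrable_cst.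
have addi f g : mu.-integrable setT (EFin \o f) -> mu.-integrable setT (EFin \o g) ->
    mu.-integrable setT (EFin \o (fun x => f x + g x)).
  move=> fi gi; rewrite (_ : EFin \o _ = ((EFin \o f) \+ (EFin \o g))%E)//.
  exact: integrableD.
have i1 := addi _ _ i0 (ic 1%N c1 isT).
have i2 := addi _ _ i1 (ic 2%N c2 isT).
have i3 := addi _ _ i2 (ic 3%N c3 isT).
have i4 := addi _ _ i3 (ic 4%N c4 isT).
split; first exact: i4.
rewrite /p (RintegralD measurableT i3 (ic 4%N c4 isT)).
rewrite (RintegralD measurableT i2 (ic 3%N c3 isT)).
rewrite (RintegralD measurableT i1 (ic 2%N c2 isT)).
rewrite (RintegralD measurableT i0 (ic 1%N c1 isT)).
rewrite Rintegral_cst//= probability_setT/= !Ic// third0 var1.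
by rewrite [X in c1 * X]mean0 -/m4; ring.
Qed.

Lemma fourth_moment_ge1 : 1 <= m4.
Proof.
have [i1 E1] := quartic_integral (-1) 0 2 0 0.
have [i2 E2] := quartic_integral 0 0 0 0 1.
have := le_Rintegral measurableT i1 i2; rewrite E1 E2.
have h x : -1 + 0 * x + 2 * x ^+ 2 + 0 * x ^+ 3 + 0 * x ^+ 4 <=
    0 + 0 * x + 0 * x ^+ 2 + 0 * x ^+ 3 + 1 * x ^+ 4.
  rewrite -subr_ge0 [leRHS](_ : _ = (x ^+ 2 - 1) ^+ 2); last by ring.
  exact: sqr_ge0.
by move=> /(_ (fun x _ => h x)); lra.
Qed.

(** The Taylor polynomial of g in x is p below.  Its x and x^3 terms average to
    0, and its constant and x^2 terms cancel because the variance is 1; only the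
    two remainders, together at most q, are left. *)
Lemma stein_summand_bound f f1 f2 f3 a L s : 0 < a ->
  (forall x, is_derive x 1 f (f1 x)) -> (forall x, is_derive x 1 f1 (f2 x)) ->
  (forall x, is_derive x 1 f2 (f3 x)) -> (forall x, `|f3 x| <= L) ->
  let g x := f1 (s + a * x) - x * f (s + a * x) / a in
  mu.-integrable setT (EFin \o g) /\
  `|\int[mu]_x g x| <= a ^+ 2 * L * (1 / 2 + m4 / 6).
Proof.
move=> a0 fd f1d f2d f3L g.
have an0 : a != 0 by rewrite gt_eqF.
have cf x : {for x, continuous f} by exact: is_derive_continuous_at (fd x).
have cf1 x : {for x, continuous f1} by exact: is_derive_continuous_at (f1d x).
have mg : measurable_fun setT g.
  have msa : measurable_fun setT (fun x => s + a * x).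
    by apply: measurable_funD => //; apply: measurable_funM.
  apply: measurable_funB.
    by apply: measurableT_comp msa; exact: continuous_measurable_fun.
  apply: measurable_funM => //; apply: measurable_funM => //.
  by apply: measurableT_comp msa; exact: continuous_measurable_fun.
(* First order in the f1 term, third order in the x f term. *)
pose p x := f1 s + (a * f2 s - f s / a) * x + (- f1 s) * x ^+ 2 +
            (- (a * f2 s / 2)) * x ^+ 3 + 0 * x ^+ 4.
have [pi pE] := quartic_integral (f1 s) (a * f2 s - f s / a) (- f1 s) (- (a * f2 s / 2)) 0.
pose q x := 0 + 0 * x + (a ^+ 2 * L / 2) * x ^+ 2 + 0 * x ^+ 3 + (a ^+ 2 * L / 6) * x ^+ 4.
have [qi qE] := quartic_integral 0 0 (a ^+ 2 * L / 2) 0 (a ^+ 2 * L / 6).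
have gpq x : `|g x - p x| <= q x.
  have := taylor1 s (a * x) f1d f2d f3L.
  have := taylor2 s (a * x) fd f1d f2d f3L.
  set e2 := (X in `|X|); set e1 := (X in _ -> `|X| <= _ -> _) => h2 h1.
  have -> : g x - p x = e1 - x / a * e2.
    by rewrite /g /p /e1 /e2; field.
  have -> : q x = L / 2 * (a * x) ^+ 2 + `|x| / a * (L / 6 * `|a * x| ^+ 3).
    have x4 : x ^+ 4 = `|x| ^+ 4 by rewrite -normrX ger0_norm// exprn_even_ge0.
    by rewrite /q x4 normrM (gtr0_norm a0); field.
  apply: (le_trans (ler_normB _ _)); apply: lerD => //.
  rewrite normrM normrM normfV (gtr0_norm a0) ler_wpM2l//.
  by rewrite divr_ge0// ltW.
have mp : measurable_fun setT p.
  by have := measurable_int _ pi => /measurable_EFinP; exact.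
have gmpi : mu.-integrable setT (EFin \o (fun x => g x - p x)).
  by apply: (integrable_dominated _ qi gpq); exact: measurable_funB.
have gi : mu.-integrable setT (EFin \o g).
  rewrite (_ : EFin \o g = ((EFin \o (fun x => (g x - p x)%R)) \+ (EFin \o p))%E).
    apply: integrableD => //.
  by apply/funext => x; rewrite /= -EFinD subrK.
split => //.
have : \int[mu]_x (g x - p x) = \int[mu]_x g x.
  rewrite (RintegralB measurableT gi pi) pE; ring.
move=> <-.
apply: (le_trans (norm_Rintegral_le _ qi gpq)); first exact: measurable_funB.
by rewrite qE; lra.
Qed.

End standardized_law.

Section moments.
Context (d : measure_display) (T : measurableType d) (R : realType).
Variables (P : probability T R) (X : {RV P >-> R}).

Lemma standardized_distribution :
  ('E_P[X] = 0)%E -> ('V_P[X] = 1)%E -> ('E_P[fun w => (X w ^+ 3)%R] = 0)%E ->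
  ('E_P[fun w => (X w ^+ 4)%R] < +oo)%E ->
  let mu := distribution P X in
  [/\ mu.-integrable setT (fun x => (x ^+ 4)%:E), \int[mu]_x x = 0,
      \int[mu]_x (x ^+ 2) = 1, \int[mu]_x (x ^+ 3) = 0 &
      \int[mu]_x (x ^+ 4) = fine 'E_P[fun w => (X w ^+ 4)%R]].
Proof.
move=> X1 X2 X3 X4 mu.
have mk k : measurable_fun [set: R] (fun x : R => (x ^+ k)%:E).
  by apply/measurable_EFinP; exact: exprn_measurable.
have mu4 : mu.-integrable setT (fun x => (x ^+ 4)%:E).
  apply/integrableP; split => //.
  rewrite ge0_integral_distribution//; last exact: measurableT_comp.
  move: X4; rewrite unlock; congr (_ < _)%E; apply: eq_integral => w _.
  by rewrite /= ger0_norm// exprn_even_ge0.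
have E k : (k <= 4)%N -> \int[mu]_x (x ^+ k) = fine 'E_P[fun w => (X w ^+ k)%R].
  by move=> kle; rewrite unlock; apply: Rintegral_distribution; exact: powers_integrable.
split => //.
- have := E 1%N isT; rewrite /= => ->.
  by rewrite (_ : (fun w => X w ^+ 1) = X)// X1.
- rewrite E//; move: X2; rewrite /variance covariance.unlock X1 /=.
  set f := (X in ('E_P[X])%E); rewrite (_ : f = (fun w => X w ^+ 2)); first by move=> ->.
  apply/funext => w; rewrite [LHS](_ : _ = (X w - 0) * (X w - 0))//.
  by rewrite subr0 expr2.
- by rewrite E// X3.
- by rewrite E.
Qed.

End moments.

(** * Normal approximation of a normalized sum *)

Section normalized_sum.
Context (d : measure_display) (T : measurableType d) (R : realType).
Variables (P : probability T R) (I : finType) (X : I -> {RV P >-> R}).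
Variables (J : {set I}) (mu : probability R R).
Hypothesis indep : mutually_independent X.
Hypothesis law : forall i, i \in J -> forall A, measurable A ->
  distribution P (X i) A = mu A.
Hypothesis mu4 : mu.-integrable setT (fun x => (x ^+ 4)%:E).
Hypothesis mean0 : \int[mu]_x x = 0.
Hypothesis var1 : \int[mu]_x (x ^+ 2) = 1.
Hypothesis third0 : \int[mu]_x (x ^+ 3) = 0.
Hypothesis J_gt0 : (0 < #|J|)%N.

Let m4 := \int[mu]_x (x ^+ 4).
Let m : R := #|J|%:R.
Let a : R := (Num.sqrt m)^-1.
Let S w := a * \sum_(i in J) X i w.

Let m_gt0 : 0 < m. Proof. by rewrite ltr0n. Qed.
Let a_gt0 : 0 < a. Proof. by rewrite invr_gt0 sqrtr_gt0. Qed.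
Let a_sq : a ^+ 2 = m^-1. Proof. by rewrite exprVn sqr_sqrtr// ltW. Qed.

Lemma measurable_normalized_sum (K : {set I}) (c : R) :
  measurable_fun setT (fun w => c * \sum_(i in K) X i w).
Proof.
apply: measurable_funM => //; under eq_fun do rewrite big_mkcond.
by apply: measurable_sum => i; case: (i \in K).
Qed.

Lemma summand_law_integral i (f : R -> R) : i \in J -> 
  \int[distribution P (X i)]_x f x = \int[mu]_x f x.
Proof.
move=> iJ; congr fine; apply: eq_measure_integral => A mA _; exact: law.
Qed.

Lemma summand_law_integrable i (f : R -> R) : i \in J ->
  mu.-integrable setT (EFin \o f) ->
  (distribution P (X i)).-integrable setT (EFin \o f).
Proof.
move=> iJ /integrableP[mf fi]; apply/integrableP; split => //.
apply: le_lt_trans fi.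
rewrite (_ : integral _ _ _ = (\int[mu]_z `|(EFin \o f) z|)%E)//.
apply: eq_measure_integral => A mA _; exact: law.
Qed.

Lemma summand_square_integrable i : i \in J -> P.-integrable setT (fun w => (X i w ^+ 2)%:E).
Proof.
move=> iJ; apply: (@integrable_distribution_comp _ _ _ _ _ P (X i) (fun x => x ^+ 2)).
exact: summand_law_integrable iJ (powers_integrable mu4 (isT : 2 <= 4)%N).
Qed.

(** Products X i X k are dominated by X i ^2 + X k ^2. *)
Lemma summand_times_sum_integrable i c0 c1 : i \in J -> 0 <= c0 -> 0 <= c1 ->
  P.-integrable setT (EFin \o (fun w => `|X i w| * (c0 + c1 * `|S w|))).
Proof.
move=> iJ c00 c10.
have mS : measurable_fun setT S by exact: measurable_normalized_sum.
have sq k : k \in J -> P.-integrable setT (fun w => (X i w ^+ 2 + X k w ^+ 2)%:E).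
  move=> kJ; rewrite (_ : (fun w => _) =
    ((EFin \o (fun w => (X i w ^+ 2)%R)) \+ (EFin \o (fun w => (X k w ^+ 2)%R)))%E)//.
  by apply: integrableD => //; exact: summand_square_integrable.
have sqc k c : k \in J ->
    P.-integrable setT (EFin \o (fun w => c * (X i w ^+ 2 + X k w ^+ 2))).
  move=> kJ; rewrite (_ : EFin \o _ =
    (fun w => c%:E * (X i w ^+ 2 + X k w ^+ 2)%:E)%E)//.
  by apply: integrableZl => //; exact: sq.
have [si _] := @Rintegral_sum R _ _ P I (enum J)
  (fun k w => c1 * a * (X i w ^+ 2 + X k w ^+ 2))
  (fun k kJ => sqc k _ (eq_ind _ is_true kJ _ (mem_enum _ _))).
have i0 : P.-integrable setT (EFin \o (fun w => c0 + c0 / 2 * (X i w ^+ 2 + X i w ^+ 2))).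
  rewrite (_ : EFin \o _ = ((EFin \o cst c0) \+
    (EFin \o (fun w => (c0 / 2 * (X i w ^+ 2 + X i w ^+ 2))%R)))%E)//.
  by apply: integrableD => //; [exact: finite_measure_integrable_cst|exact: sqc].
have qi : P.-integrable setT (EFin \o (fun w =>
    (c0 + c0 / 2 * (X i w ^+ 2 + X i w ^+ 2)) +
    \sum_(k <- enum J) c1 * a * (X i w ^+ 2 + X k w ^+ 2))).
  rewrite (_ : EFin \o _ = ((EFin \o (fun w =>
      (c0 + c0 / 2 * (X i w ^+ 2 + X i w ^+ 2))%R)) \+
    (EFin \o (fun w => (\sum_(k <- enum J) c1 * a * (X i w ^+ 2 + X k w ^+ 2))%R)))%E)//.
  exact: integrableD.
have prod_le x y : `|x| * `|y| <= x ^+ 2 + y ^+ 2 :> R.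
  rewrite -(real_normK (num_real x)) -(real_normK (num_real y)).
  by have := sqr_ge0 (`|x| - `|y|); have := sqr_ge0 `|x|; have := sqr_ge0 `|y|; nra.
apply: (integrable_dominated _ qi).
  apply: measurable_funM; first exact: measurableT_comp.
  apply: measurable_funD => //; apply: measurable_funM => //.
  exact: measurableT_comp.
move=> w; rewrite ger0_norm; last by rewrite mulr_ge0// addr_ge0// mulr_ge0.
rewrite mulrDr lerD//.
  have := sqr_ge0 (`|X i w| - 1).
  have := real_normK (num_real (X i w)).
  by nra.
rewrite big_enum/= -mulr_sumr mulrCA -mulrA ler_wpM2l//.
rewrite normrM (gtr0_norm a_gt0) mulrCA ler_wpM2l ?(ltW a_gt0)//.
apply: (@le_trans _ _ (`|X i w| * \sum_(k in J) `|X k w|)).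
  by rewrite ler_wpM2l// ler_norm_sum.
rewrite mulr_sumr; apply: ler_sum => k _; exact: prod_le.
Qed.

(** Since S = a \sum X i and a^2 = 1 / m, the integrand is the mean over i of
    g i = f1 S - X i f(S) / a.  For each i, S = S_i + a X i with S_i independent
    of X i, and averaging over X i alone gives the bound of
    [stein_summand_bound] for every value of S_i. *)
Lemma stein_sum_bound (f f1 f2 f3 : R -> R) (K L : R) :
  (forall x : R, is_derive x 1 f (f1 x)) -> (forall x : R, is_derive x 1 f1 (f2 x)) ->
  (forall x : R, is_derive x 1 f2 (f3 x)) ->
  (forall x, `|f1 x| <= K) -> (forall x, `|f3 x| <= L) ->
  P.-integrable setT (EFin \o (fun w => f1 (S w) - S w * f (S w))) /\
  `|\int[P]_w (f1 (S w) - S w * f (S w))| <= m^-1 * L * (1 / 2 + m4 / 6).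
Proof.
move=> fd f1d f2d f1K f3L.
have cf (x : R) : {for x, continuous f} by exact: is_derive_continuous_at (fd x).
have cf1 (x : R) : {for x, continuous f1} by exact: is_derive_continuous_at (f1d x).
have mf : measurable_fun setT f by exact: continuous_measurable_fun.
have mf1 : measurable_fun setT f1 by exact: continuous_measurable_fun.
have mS : measurable_fun setT S by exact: measurable_normalized_sum.
have an0 : a != 0 by rewrite gt_eqF.
have f0a : 0 <= `|f 0| / a by rewrite divr_ge0// ltW.
have Ka : 0 <= K / a.
  by rewrite divr_ge0// ?(ltW a_gt0)// (le_trans (normr_ge0 _) (f1K 0)).
pose g i w := f1 (S w) - X i w * f (S w) / a.
have fS w : `|f (S w)| <= `|f 0| + K * `|S w|.
  have := lipschitz_of_bounded_deriv fd f1K 0 (S w); rewrite subr0.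
  have : `|f (S w)| <= `|f 0| + `|f (S w) - f 0|.
    by rewrite -{1}(subrK (f 0) (f (S w))) addrC ler_normD.
  lra.
have gi i : i \in J -> P.-integrable setT (EFin \o g i).
  move=> iJ.
  have i1 : P.-integrable setT (EFin \o (fun w => f1 (S w))).
    by apply: (bounded_integrable P _ (fun w => f1K (S w))); exact: measurableT_comp.
  have i2 : P.-integrable setT (EFin \o (fun w => X i w * f (S w) / a)).
    apply: (integrable_dominated _
      (summand_times_sum_integrable iJ f0a Ka)).
      apply: measurable_funM => //; apply: measurable_funM => //.
      exact: measurableT_comp.
    move=> w; rewrite normrM normrM normfV (gtr0_norm a_gt0) -mulrA ler_wpM2l//.
    rewrite [leRHS](_ : _ = (`|f 0| + K * `|S w|) / a); last by ring.
    by rewrite ler_wpM2r// invr_ge0 ltW.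
  rewrite (_ : EFin \o _ = ((EFin \o (fun w => f1 (S w))) \-
    (EFin \o (fun w => (X i w * f (S w) / a)%R)))%E)//.
  exact: integrableB.
have gb i : i \in J -> `|\int[P]_w g i w| <= a ^+ 2 * L * (1 / 2 + m4 / 6).
  move=> iJ.
  pose Si w := a * \sum_(k in J :\ i) X k w.
  pose B : {mfun T >-> R} := mfun_of (measurable_normalized_sum (J :\ i) a).
  have SE w : S w = Si w + a * X i w.
    by rewrite /S /Si (big_setD1 i)//= mulrDr addrC.
  have XB : indep_pair P (X i) B.
    move=> E F mE mF.
    have := block_sums_indep indep 1 a (_ : [disjoint [set i]%SET & J :\ i]%B) mE mF.
    rewrite /= (_ : (fun w => 1 * _) = X i); first apply.
      by rewrite disjoints1 !inE eqxx.
    by apply/funext => w; rewrite big_set1 mul1r.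
  pose G (z : R * R) := f1 (z.2 + a * z.1) - z.1 * f (z.2 + a * z.1) / a.
  have gG w : g i w = G (X i w, B w) by rewrite /g /G /= SE.
  have sb s := stein_summand_bound mu4 mean0 var1 third0 s a_gt0 fd f1d f2d f3L.
  have mG : measurable_fun setT G.
    have mza : measurable_fun setT (fun z : R * R => z.2 + a * z.1).
      by apply: measurable_funD => //; apply: measurable_funM.
    apply: measurable_funB; first exact: measurableT_comp mza.
    apply: measurable_funM => //; apply: measurable_funM => //.
    exact: measurableT_comp mza.
  have -> : \int[P]_w g i w = \int[P]_w G (X i w, B w).
    by apply: eq_Rintegral => w _; exact: gG.
  have [||mH ->] := integral_indep_pair XB mG.
  - have -> : (fun w => (G (X i w, B w))%:E) = EFin \o g i.
      by apply/funext => w; rewrite /= gG.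
    exact: gi.
  - by move=> s; apply: summand_law_integrable => //; have [] := sb s.
  set D := distribution P B.
  have H s : `|\int[distribution P (X i)]_x G (x, s)| <= a ^+ 2 * L * (1 / 2 + m4 / 6).
    by rewrite summand_law_integral//; have [] := sb s.
  have := Rintegral_bound D mH measurableT H.
  by rewrite probability_setT mulr1.
have gmi : {in enum J, forall i,
    P.-integrable setT (EFin \o (fun w => m^-1 * g i w))}.
  move=> i; rewrite mem_enum => iJ.
  rewrite (_ : EFin \o _ = (fun w => (m^-1)%:E * (g i w)%:E)%E)//.
  by apply: integrableZl => //; exact: gi.
have [si Is] := Rintegral_sum gmi.
have mn0 : m != 0 by rewrite gt_eqF.
have gE w : \sum_(i <- enum J) m^-1 * g i w = f1 (S w) - S w * f (S w).
  rewrite big_enum/= -mulr_sumr sumrB sumr_const -mulr_natl mulrBr -/m mulKf//.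
  by congr (_ - _); rewrite -2!mulr_suml -a_sq /S; field.
have fE : (fun w => f1 (S w) - S w * f (S w)) =
    (fun w => \sum_(i <- enum J) m^-1 * g i w).
  by apply/funext => w; rewrite gE.
rewrite fE; split => //; rewrite Is big_enum/= (le_trans (ler_norm_sum _ _ _))//.
apply: (@le_trans _ _ (\sum_(i in J) m^-1 * (m^-1 * L * (1 / 2 + m4 / 6)))).
  apply: ler_sum => i iJ.
  rewrite RintegralZl//; last exact: gi.
  rewrite normrM (gtr0_norm (_ : 0 < m^-1)) ?invr_gt0//.
  by rewrite ler_wpM2l// ?invr_ge0 ?(ltW m_gt0)// -[X in X * L]a_sq gb.
by rewrite sumr_const -[_ *+ #|J|]mulr_natl -/m mulVKf.
Qed.

(** The case f x = x of [stein_sum_bound], whose third derivative is 0. *)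
Lemma normalized_sum_second_moment :
  P.-integrable setT (EFin \o (fun w => S w ^+ 2)) /\ \int[P]_w (S w ^+ 2) = 1.
Proof.
have idd (x : R) : is_derive x 1 (id : R -> R) (cst 1 x) by exact: is_derive_id.
have d1 (x : R) : is_derive x 1 (cst 1 : R -> R) (cst 0 x) by exact: is_derive_cst.
have d0 (x : R) : is_derive x 1 (cst 0 : R -> R) (cst 0 x) by exact: is_derive_cst.
have b1 (x : R) : `|cst 1 x : R| <= 1 by rewrite normr1.
have b0 (x : R) : `|cst 0 x : R| <= 0 by rewrite normr0.
have [] := stein_sum_bound idd d1 d0 b1 b0.
rewrite mulr0 mul0r normr_le0 => si /eqP E.
have ci : P.-integrable setT (EFin \o cst (1 : R)) by exact: finite_measure_integrable_cst.
have sE : (fun w => S w ^+ 2) = (fun w => cst 1 w - (1 - S w * S w)).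
  by apply/funext => w /=; ring.
rewrite sE; split.
  rewrite (_ : EFin \o _ = ((EFin \o cst 1%R) \-
    (EFin \o (fun w => (1 - S w * S w)%R)))%E)//.
  exact: integrableB.
rewrite (RintegralB measurableT ci si) E subr0 Rintegral_cst//=.
by rewrite probability_setT mulr1.
Qed.

(** The constant: ||f'''|| <= 4 M, and 1/2 + m4/6 <= 2 m4 / 3 as m4 >= 1. *)
Lemma normalized_sum_clt_bound (g g' g'' : R -> R) (B B1 M : R) :
  (forall x : R, is_derive x 1 g (g' x)) ->
  (forall x : R, is_derive x 1 g' (g'' x)) ->
  (forall x, `|g x| <= B) -> (forall x, `|g' x| <= B1) ->
  (forall x, `|g'' x| <= M) ->
  `|\int[P]_w g (S w) - \int[normal_prob (0 : R) 1]_z g z| <= 8 / 3 * M * m4 / m.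
Proof.
move=> gd g'd gB gB1 gM.
have [f [f1 [f2 [f3 [K [fd f1d f2d [fE f1K f3M]]]]]]] :=
  stein_solution gd g'd gB gB1 gM.
have [_] := stein_sum_bound fd f1d f2d f1K f3M.
set c := \int[normal_prob 0 1]_y g y in fE *.
have mg : measurable_fun setT g.
  by apply: continuous_measurable_fun => x; exact: is_derive_continuous_at (gd x).
have gi : P.-integrable setT (EFin \o (fun w => g (S w))).
  apply: (bounded_integrable P _ (fun w => gB (S w))).
  apply: measurableT_comp => //; exact: measurable_normalized_sum.
have ci : P.-integrable setT (EFin \o cst c) by exact: finite_measure_integrable_cst.
under eq_Rintegral do rewrite fE.
rewrite (RintegralB measurableT gi ci) Rintegral_cst//= probability_setT mulr1.
move=> /le_trans; apply.
have M0 : 0 <= M by rewrite (le_trans (normr_ge0 _) (gM 0)).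
have m41 : 1 <= m4 by exact: fourth_moment_ge1.
rewrite [leRHS](_ : _ = m^-1 * (4 * M) * (2 / 3 * m4)); last by field; rewrite gt_eqF.
rewrite ler_wpM2l ?mulr_ge0 ?invr_ge0 ?(ltW m_gt0)//.
lra.
Qed.

End normalized_sum.

(** * Scale mixtures *)

Section mixtures.
Variable R : realType.
Variables (h : R -> R) (B : R).
Hypothesis mh : measurable_fun setT h.
Hypothesis hB : forall x, `|h x| <= B.
Implicit Types (m n : probability R R) (u s : R).

Let hmul_integrable m n : (m \x n)%E.-integrable setT (fun z => (h (z.1 * z.2))%:E).
Proof.
apply: (bounded_integrable (m \x n)%E (B := B)) => //.
by apply: measurableT_comp => //; exact: measurable_funM.
Qed.

Let hscale_measurable u : measurable_fun setT (fun s => h (s * u)).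
Proof. by apply: measurableT_comp => //; exact: measurable_funM. Qed.

Let hscale_integrable m u : m.-integrable setT (EFin \o (fun s => h (s * u))).
Proof. by apply: (bounded_integrable m (B := B)). Qed.

Let scale_averageE m u :
  (\int[m]_s (h (s * u))%:E)%E = (\int[m]_s h (s * u))%:E.
Proof. by rewrite fineK//; exact: integrable_fin_num (hscale_integrable m u). Qed.

Lemma measurable_scale_average m :
  measurable_fun setT (fun u => \int[m]_s h (s * u)).
Proof.
apply/measurable_EFinP; rewrite (_ : EFin \o _ =
    fubini_G m (fun z : R * R => (h (z.1 * z.2))%:E)).
  exact: (measurable_fubini_G (hmul_integrable m m)).
by apply/funext => u; rewrite /= -scale_averageE.
Qed.

Lemma scale_average_bound m u : `|\int[m]_s h (s * u)| <= B.
Proof.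
have := Rintegral_bound m (@hscale_measurable u) measurableT (fun s => hB _).
by rewrite probability_setT mulr1.
Qed.

Lemma scale_average_swap m n :
  \int[n]_u \int[m]_s h (s * u) = \int[m]_s \int[n]_u h (u * s).
Proof.
have i := hmul_integrable m n.
have E1 := integral21_prod_meas1 i; have E2 := integral12_prod_meas1 i.
rewrite /Rintegral; congr fine.
transitivity (\int[(m \x n)%E]_z (h (z.1 * z.2))%:E)%E.
  by rewrite -E1; apply: eq_integral => u _; rewrite -scale_averageE.
rewrite -E2; apply: eq_integral => s _; rewrite -[RHS]scale_averageE.
by apply: eq_integral => u _; rewrite mulrC.
Qed.

(** With the scale drawn from a law of second moment at most 1, an error of
    C u^2 at scale u becomes an error of C. *)
Lemma mixture_comparison m1 m2 n C :
  n.-integrable setT (fun u => (u ^+ 2)%:E) -> \int[n]_u (u ^+ 2) <= 1 ->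
  (forall u, `|\int[m1]_s h (s * u) - \int[m2]_s h (s * u)| <= C * u ^+ 2) ->
  0 <= C ->
  `|\int[n]_u \int[m1]_s h (s * u) - \int[n]_u \int[m2]_s h (s * u)| <= C.
Proof.
move=> n2 nle CE C0.
have ai m : n.-integrable setT (EFin \o (fun u => \int[m]_s h (s * u))).
  apply: (bounded_integrable n (B := B)); first exact: measurable_scale_average.
  exact: scale_average_bound.
rewrite -(RintegralB measurableT (ai m1) (ai m2)).
have ci : n.-integrable setT (EFin \o (fun u => C * u ^+ 2)).
  rewrite (_ : EFin \o _ = (fun u => C%:E * (u ^+ 2)%:E)%E)//.
  exact: integrableZl.
apply: (le_trans (norm_Rintegral_le _ ci CE)).
  by apply: measurable_funB; exact: measurable_scale_average.
by rewrite RintegralZl// ler_piMr.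
Qed.

End mixtures.

Section standard_normal.
Variable R : realType.
Notation gamma := (normal_prob (0 : R) 1).

(** The identity only changes the type: [normal_prob] is a measure on the
    sigma-algebra generated by half-open intervals, and the laws of real random
    variables are measures on the sigma-algebra that R itself carries. *)
Definition std_normal : probability R R := distribution gamma
  (mfun_of (@measurable_id _ (measurableTypeR R) setT
    : measurable_fun setT (idfun : measurableTypeR R -> R))).

Lemma Rintegral_std_normal (g : R -> R) B : measurable_fun setT g ->
  (forall x, `|g x| <= B) -> \int[std_normal]_x g x = \int[gamma]_x g x.
Proof.
move=> mg gB; apply: Rintegral_distribution.
exact: (bounded_integrable std_normal mg gB).
Qed.

Lemma std_normal_second_moment : std_normal.-integrable setT (fun u : R => (u ^+ 2)%:E) /\
  \int[std_normal]_u (u ^+ 2) <= 1.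
Proof.
have m2 : measurable_fun [set: R] (fun u : R => (u ^+ 2)%:E).
  by apply/measurable_EFinP; exact: exprn_measurable.
have E : (\int[std_normal]_u (u ^+ 2)%:E = \int[gamma]_u (u ^+ 2)%:E)%E.
  by rewrite ge0_integral_distribution// => y; rewrite lee_fin sqr_ge0.
have I : std_normal.-integrable setT (fun u : R => (u ^+ 2)%:E).
  apply/integrableP; split => //.
  under eq_integral do rewrite gee0_abs ?lee_fin ?sqr_ge0//.
  by rewrite E (le_lt_trans (gaussian_second_moment R))// ltry.
split => //; rewrite -lee_fin /Rintegral fineK; last exact: integrable_fin_num.
by rewrite E; exact: gaussian_second_moment.
Qed.

Lemma PN21E (h : R -> R) B : measurable_fun setT h -> (forall x, `|h x| <= B) ->
  PN21 h = \int[std_normal]_z \int[std_normal]_s h (s * z).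
Proof.
move=> mh hB; rewrite /PN21 unlock.
have i : (gamma \x gamma)%E.-integrable setT
    (EFin \o (fun z : measurableTypeR R * measurableTypeR R => h (z.1 * z.2))).
  apply: (bounded_integrable (gamma \x gamma)%E (B := B)) => //.
  apply: measurableT_comp => //.
  by apply: (@measurable_funM _ (measurableTypeR R * measurableTypeR R)%type R setT fst snd).
have hs z : measurable_fun setT (fun s : R => h (s * z)).
  by apply: measurableT_comp => //; exact: measurable_funM.
have gE z : \int[std_normal]_s h (s * z) = \int[gamma]_s h (s * z).
  by apply: (Rintegral_std_normal (hs z) (B := B)) => s.
rewrite (Rintegral_std_normal (measurable_scale_average mh hB std_normal)
  (scale_average_bound mh hB std_normal)).
under [RHS]eq_Rintegral do rewrite gE.
congr fine; rewrite -(integral21_prod_meas1 i); apply: eq_integral => z _.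
rewrite /Rintegral fineK//; apply: integrable_fin_num => //.
exact: (bounded_integrable gamma (hs z) (B := B)).
Qed.

End standard_normal.

(** * The product of two sums *)

Section supnorm.
Variable R : realType.
Implicit Types (g : R -> R).

Lemma le_supnorm g x : bounded_fun g -> `|g x| <= supnorm g.
Proof.
move=> [M [_ gM]]; apply: ub_le_sup; last by exists x.
exists (M + 1) => _ [y _ <-]; apply: gM => //; by rewrite ltrDl.
Qed.

Lemma supnorm_ge0 g : 0 <= supnorm g.
Proof.
rewrite /supnorm; have [hs|/sup_out -> //] := pselect (has_sup (range (fun x => `|g x|))).
by apply: (le_trans (normr_ge0 (g 0))); apply: (sup_upper_bound hs); exists 0.
Qed.

End supnorm.

(** Each replacement costs 8/3 of the norm M of the second derivative times one
    fourth moment; the other fourth moment is at least 1. *)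
Lemma dominating_constant (R : realType) (M N1 N0 kX kY p q : R) :
  0 <= M -> 0 <= N1 -> 0 <= N0 -> 1 <= kX -> 1 <= kY -> 0 <= p -> 0 <= q ->
  8 / 3 * M * kX * p + 8 / 3 * M * kY * q <=
  (p + q) * (7 / 2 * M + N1 + 123 / 4 * N0) * kX * kY.
Proof.
move=> M0 N10 N00 kX1 kY1 p0 q0.
pose A := 7 / 2 * M + N1 + 123 / 4 * N0.
have AM : 8 / 3 * M <= A by rewrite /A; lra.
have M83 : 0 <= 8 / 3 * M by lra.
have kX0 : 0 <= kX by exact: le_trans ler01 kX1.
have kY0 : 0 <= kY by exact: le_trans ler01 kY1.
have kXY1 : kX <= kX * kY by rewrite ler_peMr.
have kXY2 : kY <= kX * kY by rewrite ler_peMl.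
rewrite [leRHS](_ : _ = A * (kX * kY) * p + A * (kX * kY) * q); last by rewrite /A; ring.
by apply: lerD; rewrite ler_wpM2r// ler_pM.
Qed.

Theorem corollary4p3 (R : realType) (d : measure_display)
    (T : measurableType d) (P : probability T R) (m n : nat)
    (X : {RV P >-> R}) (Xs : 'I_m -> {RV P >-> R})
    (Y : {RV P >-> R}) (Ys : 'I_n -> {RV P >-> R}) (h : R -> R)
    (m_gt0 : (0 < m)%N) (n_gt0 : (0 < n)%N)
    (indep : mutually_independent
               (join_families (with_copies X Xs) (with_copies Y Ys)))
    (X_mean0 : forall i, ('E_P[with_copies X Xs i] = 0)%E)
    (X_var1 : forall i, ('V_P[with_copies X Xs i] = 1)%E)
    (Y_mean0 : forall j, ('E_P[with_copies Y Ys j] = 0)%E)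
    (Y_var1 : forall j, ('V_P[with_copies Y Ys j] = 1)%E)
    (Xs_eqd : forall i, eq_in_distribution (Xs i) X)
    (Ys_eqd : forall j, eq_in_distribution (Ys j) Y)
    (X_third : ('E_P[fun w => (X w ^+ 3)%R] = 0)%E)
    (Y_third : ('E_P[fun w => (Y w ^+ 3)%R] = 0)%E)
    (X_fourth : ('E_P[fun w => (X w ^+ 4)%R] < +oo)%E)
    (Y_fourth : ('E_P[fun w => (Y w ^+ 4)%R] < +oo)%E)
    (hCb2 : Cb2 h) :
  let W1 := fun w : T => \sum_(i < m) Xs i w in
  let W2 := fun w : T => \sum_(j < n) Ys j w in
  let W := fun w : T => (Num.sqrt (m%:R * n%:R))^-1 * (W1 w * W2 w) in
  `| fine 'E_P[fun w => h (W w)] - PN21 h |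
  <= (m%:R^-1 + n%:R^-1)
     * (7 / 2 * supnorm h^`(2) + supnorm h^`()
        + 123 / 4 * supnorm (fun x => h x - PN21 h))
     * fine 'E_P[fun w => (X w ^+ 4)%R] * fine 'E_P[fun w => (Y w ^+ 4)%R].
Proof.
cbv zeta.
pose W1 w := \sum_(i < m) Xs i w; pose W2 w := \sum_(j < n) Ys j w.
pose W w := (Num.sqrt (m%:R * n%:R))^-1 * (W1 w * W2 w).
have [h_der h'_der [h_bd h'_bd h''_bd]] := hCb2.
have hd (x : R) : is_derive x 1 h (h^`() x).
  by rewrite derive1E; exact: derivableP.
have h'd (x : R) : is_derive x 1 h^`() (h^`(2) x).
  by rewrite derive1nS /= derive1E; exact: derivableP.
pose B := supnorm h; pose B1 := supnorm h^`().
have hB x : `|h x| <= B := le_supnorm x h_bd.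
have hB1 x : `|h^`() x| <= B1 := le_supnorm x h'_bd.
have hM x := le_supnorm x h''_bd.
have M0 := supnorm_ge0 h^`(2).
move: (supnorm h^`(2)) hM M0 => M hM M0.
clearbody B B1.
have mh : measurable_fun setT h.
  by apply: continuous_measurable_fun => x; exact: is_derive_continuous_at (hd x).
have [muX4 X1 X2 X3 X4] := standardized_distribution
  (X_mean0 None) (X_var1 None) X_third X_fourth.
have [muY4 Y1 Y2 Y3 Y4] := standardized_distribution
  (Y_mean0 None) (Y_var1 None) Y_third Y_fourth.
set kX := fine 'E_P[fun w => (X w ^+ 4)%R] in X4 *.
set kY := fine 'E_P[fun w => (Y w ^+ 4)%R] in Y4 *.
pose fam := join_families (with_copies X Xs) (with_copies Y Ys).
(* The blocks leave out the index None, that is, X and Y themselves. *)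
pose J1 : {set option 'I_m + option 'I_n} := (fun i => inl (Some i)) @: [set: 'I_m]%SET.
pose J2 : {set option 'I_m + option 'I_n} := (fun j => inr (Some j)) @: [set: 'I_n]%SET.
have J1inj : injective (fun i : 'I_m => inl (Some i) : option 'I_m + option 'I_n).
  by move=> i i' [].
have J2inj : injective (fun j : 'I_n => inr (Some j) : option 'I_m + option 'I_n).
  by move=> j j' [].
have cJ1 : #|J1| = m by rewrite card_imset// cardsT card_ord.
have cJ2 : #|J2| = n by rewrite card_imset// cardsT card_ord.
have J12 : [disjoint J1 & J2]%B.
  apply/pred0P => k /=; apply/negP => /andP[/imsetP[i _ ->] /imsetP[j _]].
  by [].
have law1 k : k \in J1 -> forall A, measurable A ->
    distribution P (fam k) A = distribution P X A.
  by move=> /imsetP[i _ ->] A mA; exact: Xs_eqd.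
have law2 k : k \in J2 -> forall A, measurable A ->
    distribution P (fam k) A = distribution P Y A.
  by move=> /imsetP[j _ ->] A mA; exact: Ys_eqd.
have J1_gt0 : (0 < #|J1|)%N by rewrite cJ1.
have J2_gt0 : (0 < #|J2|)%N by rewrite cJ2.
pose a1 : R := (Num.sqrt #|J1|%:R)^-1; pose a2 : R := (Num.sqrt #|J2|%:R)^-1.
have sum1 w : \sum_(k in J1) fam k w = W1 w.
  rewrite big_imset/=; last by move=> i i' _ _; exact: J1inj.
  by apply: eq_bigl => i; rewrite inE.
have sum2 w : \sum_(k in J2) fam k w = W2 w.
  rewrite big_imset/=; last by move=> j j' _ _; exact: J2inj.
  by apply: eq_bigl => j; rewrite inE.
pose S : {mfun T >-> R} := mfun_of (measurable_normalized_sum fam J1 a1).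
pose U : {mfun T >-> R} := mfun_of (measurable_normalized_sum fam J2 a2).
have WE w : W w = S w * U w.
  rewrite /W /S /U /= sum1 sum2 /a1 /a2 cJ1 cJ2 sqrtrM ?ler0n// invfM.
  by rewrite mulrACA.
have SU : indep_pair P S U.
  by move=> E F mE mF; exact: (block_sums_indep indep a1 a2 J12 mE mF).
have [U2i U2] := normalized_sum_second_moment indep law2 muY4 Y1 Y2 Y3 J2_gt0.
have kX1 : 1 <= kX by rewrite -X4; exact: fourth_moment_ge1.
have kY1 : 1 <= kY by rewrite -Y4; exact: fourth_moment_ge1.
(* For a fixed factor u, the test function s |-> h (s * u) and its first two
   derivatives. *)
pose h' : R -> R := h^`(); pose h'' : R -> R := h^`(2).
have scaled (u x : R) : is_derive x 1 (fun s : R => h (s * u)) (u * h' (x * u)).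
  have ud : is_derive x 1 (id * cst u) u.
    by apply: is_derive_eq; rewrite /GRing.scale/= ?fctE; ring.
  rewrite [u * _]mulrC; exact: (is_derive1_comp (hd ((id * cst u) x)) ud).
have scaled' (u x : R) :
    is_derive x 1 (fun s : R => u * h' (s * u)) (u ^+ 2 * h'' (x * u)).
  have ud : is_derive x 1 (id * cst u) u.
    by apply: is_derive_eq; rewrite /GRing.scale/= ?fctE; ring.
  have h'ud : is_derive x 1 (h' \o (id * cst u)) (h'' (x * u) * u).
    exact: (is_derive1_comp (h'd ((id * cst u) x)) ud).
  have -> : (fun s : R => u * h' (s * u)) = cst u * (h' \o (id * cst u)) by [].
  by apply: is_derive_eq; rewrite /GRing.scale/= ?fctE; ring.
have scaled_bound (u s : R) : `|h (s * u)| <= B by exact: hB.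
have scaled'_bound (u s : R) : `|u * h' (s * u)| <= `|u| * B1.
  by rewrite normrM ler_wpM2l.
have scaled''_bound (u s : R) : `|u ^+ 2 * h'' (s * u)| <= u ^+ 2 * M.
  by rewrite normrM ger0_norm ?sqr_ge0// ler_wpM2l// sqr_ge0.
have hscale_meas (u : R) : measurable_fun setT (fun s : R => h (s * u)).
  by apply: measurableT_comp => //; exact: measurable_funM.
have cltS u : `|\int[distribution P S]_s h (s * u) - \int[std_normal R]_s h (s * u)|
    <= 8 / 3 * M * kX / m%:R * u ^+ 2.
  have := normalized_sum_clt_bound indep law1 muX4 X1 X2 X3 J1_gt0
    (scaled u) (scaled' u) (scaled_bound u) (scaled'_bound u) (scaled''_bound u).
  rewrite (Rintegral_std_normal (hscale_meas u) (scaled_bound u)).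
  rewrite Rintegral_distribution; last first.
    exact: (bounded_integrable (distribution P S) (hscale_meas u) (scaled_bound u)).
  by rewrite X4 => /le_trans; apply; rewrite cJ1; lra.
have cltU u : `|\int[distribution P U]_s h (s * u) - \int[std_normal R]_s h (s * u)|
    <= 8 / 3 * M * kY / n%:R * u ^+ 2.
  have := normalized_sum_clt_bound indep law2 muY4 Y1 Y2 Y3 J2_gt0
    (scaled u) (scaled' u) (scaled_bound u) (scaled'_bound u) (scaled''_bound u).
  rewrite (Rintegral_std_normal (hscale_meas u) (scaled_bound u)).
  rewrite Rintegral_distribution; last first.
    exact: (bounded_integrable (distribution P U) (hscale_meas u) (scaled_bound u)).
  by rewrite Y4 => /le_trans; apply; rewrite cJ2; lra.
have EhW : fine 'E_P[fun w => h (W w)] =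
    \int[distribution P U]_u \int[distribution P S]_s h (s * u).
  pose g (z : R * R) := h (z.1 * z.2).
  have mg : measurable_fun setT g.
    by apply: measurableT_comp => //; exact: measurable_funM.
  have gi : P.-integrable setT (EFin \o (fun w => g (S w, U w))).
    apply: (bounded_integrable P _ (fun w => hB _)).
    by apply: measurableT_comp => //; exact: measurable_funM.
  have gsi s : (distribution P S).-integrable setT (fun x => (g (x, s))%:E).
    exact: (bounded_integrable (distribution P S) (hscale_meas s) (scaled_bound s)).
  have [_ <-] := integral_indep_pair SU mg gi gsi.
  by rewrite unlock; congr fine; apply: eq_integral => w _; rewrite WE.
have lawU2i : (distribution P U).-integrable setT (fun u => (u ^+ 2)%:E).
  apply: integrable_pushforward => //.
  by apply/measurable_EFinP; exact: exprn_measurable.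
have lawU2 : \int[distribution P U]_u (u ^+ 2) <= 1.
  by rewrite Rintegral_distribution// U2.
have c1 : 0 <= 8 / 3 * M * kX / m%:R.
  by rewrite divr_ge0// mulr_ge0// ?mulr_ge0// (le_trans ler01).
have c2 : 0 <= 8 / 3 * M * kY / n%:R.
  by rewrite divr_ge0// mulr_ge0// ?mulr_ge0// (le_trans ler01).
(* The two replacements meet, after Fubini, at S replaced by a normal and U
   kept. *)
have [gauss2i gauss2] := std_normal_second_moment R.
have step1 := mixture_comparison mh hB lawU2i lawU2 cltS c1.
have step2 := mixture_comparison mh hB gauss2i gauss2 cltU c2.
rewrite (scale_average_swap mh hB (distribution P U)) in step2.
rewrite EhW (PN21E mh hB).
apply: (le_trans (ler_distD (\int[distribution P U]_u \int[std_normal R]_s h (s * u)) _ _)).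
apply: (le_trans (lerD step1 step2)).
have N1 : 0 <= supnorm h^`() by exact: supnorm_ge0.
have N0 : 0 <= supnorm (fun x => h x - \int[std_normal R]_z \int[std_normal R]_s h (s * z)).
  exact: supnorm_ge0.
have m0 : 0 <= m%:R^-1 :> R by rewrite invr_ge0.
have n0 : 0 <= n%:R^-1 :> R by rewrite invr_ge0.
exact: dominating_constant M0 N1 N0 kX1 kY1 m0 n0.
Qed.
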